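(* Let $H$ be a Hilbert module over a $C^*$-algebra. For every idempotent $Q\in\mathcal{L}(H)$, we have $m(I-Q)=I-m(Q)$, where $m(\cdot)$ denotes the matched projection.
   Context: $\mathcal{L}(H)$ is the $C^*$-algebra of adjointable operators on the Hilbert $C^*$-module $H$, and $I$ is the identity operator on $H$. $\mathcal{R}(\cdot)$ and $\mathcal{N}(\cdot)$ denote range and null space. An idempotent is $Q\in\mathcal{L}(H)$ with $Q^2=Q$; a projection is a self-adjoint idempotent. $P_{\mathcal{R}(Q)}$ is the projection of $H$ onto the (orthogonally complemented) range of $Q$. Definition of the matched projection $m(Q)$ of an idempotent $Q\in\mathcal{L}(H)$: if $Q$ is a projection, $m(Q)=Q$. Otherwise, $H=\mathcal{R}(Q)\dotplus\mathcal{N}(Q^* )$ is an orthogonal decomposition; let $U:H\to\mathcal{R}(Q)\oplus\mathcal{N}(Q^* )$ be the unitary $Uh=\binom{P_{\mathcal{R}(Q)}h}{(I-P_{\mathcal{R}(Q)})h}$, let $I_1$ be the identity on $\mathcal{R}(Q)$, let $A=(Q-P_{\mathcal{R}(Q)})|_{\mathcal{N}(Q^* )}:\mathcal{N}(Q^* )\to\mathcal{R}(Q)$ and $B=(AA^*+I_1)^{1/2}$, and set $$m(Q)=U^*\cdot\frac12\begin{pmatrix}(B+I_1)B^{-1} & B^{-1}A\\ A^*B^{-1} & A^*[B(B+I_1)]^{-1}A\end{pmatrix}\cdot U .$$ *)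

(* Defs.v *)
From HB Require Import structures.
From mathcomp Require Import all_boot all_order all_algebra.
From mathcomp Require Import all_classical all_reals all_analysis.
From mathcomp Require Export complex.

Set Implicit Arguments.
Unset Strict Implicit.
Unset Printing Implicit Defensive.

Import Order.TTheory GRing.Theory Num.Theory.
Import numFieldNormedType.Exports.

Local Open Scope classical_set_scope.
Local Open Scope ring_scope.
Local Open Scope complex_scope.

(* C*-algebras are not assumed to be unital, and the zero algebra is allowed.
   The norm of a normed module over R[i] is a nonnegative element of R[i].    *)

HB.mixin Record isCStarAlgebra (R : realType) A
    of CompleteNormedModule R[i] A := {
  amul : A -> A -> A;
  astar : A -> A;
  amulA : associative amul;
  amulDl : left_distributive amul +%R;
  amulDr : right_distributive amul +%R;
  amulZl : forall (c : R[i]) a b, amul (c *: a) b = c *: amul a b;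
  amulZr : forall (c : R[i]) a b, amul a (c *: b) = c *: amul a b;
  astarK : involutive astar;
  astarD : {morph astar : a b / a + b};
  astarZ : forall (c : R[i]) a, astar (c *: a) = c^* *: astar a;
  astarM : forall a b, astar (amul a b) = amul (astar b) (astar a);
  ler_norm_amul : forall a b, `|amul a b| <= `|a| * `|b|;
  norm_astar_amul : forall a, `|amul (astar a) a| = `|a| ^+ 2
}.

#[short(type="cstarAlgType")]
HB.structure Definition CStarAlgebra (R : realType) :=
  {A of isCStarAlgebra R A & CompleteNormedModule R[i] A}.

Definition apos (R : realType) (A : cstarAlgType R) (a : A) : Prop :=
  exists b : A, a = amul (astar b) b.

(* Right A-modules with an A-valued form, conjugate-linear in its first
   argument and A-linear in the second one. The two positivity axioms of an
   inner product are kept apart because adjoints make sense without them: the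
   form of a direct sum is then available without having to prove that a sum
   of positive elements of a C*-algebra is positive.                          *)

HB.mixin Record isHermModule (R : realType) (A : cstarAlgType R) E
    of GRing.Lmodule R[i] E := {
  ract : E -> A -> E;
  ip : E -> E -> A;
  ractDl : forall x y a, ract (x + y) a = ract x a + ract y a;
  ractDr : forall x a b, ract x (a + b) = ract x a + ract x b;
  ractA : forall x a b, ract (ract x a) b = ract x (amul a b);
  ractZl : forall (c : R[i]) x a, ract (c *: x) a = c *: ract x a;
  ractZr : forall (c : R[i]) x a, ract x (c *: a) = c *: ract x a;
  ipDr : forall x y z, ip x (y + z) = ip x y + ip x z;
  ipZr : forall (c : R[i]) x y, ip x (c *: y) = c *: ip x y;
  ip_ractr : forall x y a, ip x (ract y a) = amul (ip x y) a;
  ipC : forall x y, ip y x = astar (ip x y)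
}.

#[short(type="hermModType")]
HB.structure Definition HermModule (R : realType) (A : cstarAlgType R) :=
  {E of isHermModule R A E & GRing.Lmodule R[i] E}.

HB.mixin Record isInnerProductModule (R : realType) (A : cstarAlgType R) E
    of HermModule R A E := {
  ip_pos : forall x : E, apos (ip x x);
  ip_eq0 : forall x : E, ip x x = 0 -> x = 0
}.

#[short(type="ipModType")]
HB.structure Definition InnerProductModule (R : realType)
  (A : cstarAlgType R) := {E of isInnerProductModule R A E & HermModule R A E}.

HB.mixin Record isHilbertModule (R : realType) (A : cstarAlgType R) E
    of InnerProductModule R A E & CompleteNormedModule R[i] E := {
  norm_ip : forall x : E, `|x| ^+ 2 = `|ip x x|
}.

#[short(type="hilbertModType")]
HB.structure Definition HilbertModule (R : realType) (A : cstarAlgType R) :=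
  {E of isHilbertModule R A E & InnerProductModule R A E
      & CompleteNormedModule R[i] E}.

Section DirectSum.
Context (R : realType) (A : cstarAlgType R) (E F : hermModType A).

Let pract (u : E * F) (a : A) : E * F := (ract u.1 a, ract u.2 a).
Let pip (u v : E * F) : A := ip u.1 v.1 + ip u.2 v.2.

Let practDl x y a : pract (x + y) a = pract x a + pract y a.
Proof. by rewrite /pract /= !ractDl. Qed.
Let practDr x a b : pract x (a + b) = pract x a + pract x b.
Proof. by rewrite /pract /= !ractDr. Qed.
Let practA x a b : pract (pract x a) b = pract x (amul a b).
Proof. by rewrite /pract /= !ractA. Qed.
Let practZl (c : R[i]) x a : pract (c *: x) a = c *: pract x a.
Proof. by rewrite /pract /= !ractZl. Qed.
Let practZr (c : R[i]) x a : pract x (c *: a) = c *: pract x a.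
Proof. by rewrite /pract /= !ractZr. Qed.
Let pipDr x y z : pip x (y + z) = pip x y + pip x z.
Proof. by rewrite /pip /= !ipDr addrACA. Qed.
Let pipZr (c : R[i]) x y : pip x (c *: y) = c *: pip x y.
Proof. by rewrite /pip /= !ipZr scalerDr. Qed.
Let pip_ractr x y a : pip x (pract y a) = amul (pip x y) a.
Proof. by rewrite /pip /= !ip_ractr amulDl. Qed.
Let pipC x y : pip y x = astar (pip x y).
Proof. by rewrite /pip astarD -!ipC. Qed.

HB.instance Definition _ := isHermModule.Build R A (E * F)%type
  practDl practDr practA practZl practZr pipDr pipZr pip_ractr pipC.

End DirectSum.

Section Submodule.
Context (R : realType) (A : cstarAlgType R).

Record submodule (E : ipModType A) := Submodule {
  subm_pred :> {pred E};
  subm_closed : subsemimod_closed subm_pred;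
  subm_ract : forall x a, x \in subm_pred -> ract x a \in subm_pred
}.

Record subm_type (E : ipModType A) (S : submodule E) := SubmElt {
  subm_val : E;
  _ : subm_val \in subm_pred S
}.

Context (E : ipModType A) (S : submodule E).

HB.instance Definition _ := [isSub of subm_type S for @subm_val E S].
HB.instance Definition _ := [Choice of subm_type S by <:].
HB.instance Definition _ := GRing.SubChoice_isSubLmodule.Build
  R[i] E (subm_pred S) (subm_type S) (subm_closed S).

Let sract (u : subm_type S) (a : A) : subm_type S :=
  Sub (ract (val u) a) (subm_ract a (valP u)).
Let sip (u v : subm_type S) : A := ip (val u) (val v).

Let sractDl x y a : sract (x + y) a = sract x a + sract y a.
Proof. by apply: val_inj; rewrite /= !ractDl. Qed.
Let sractDr x a b : sract x (a + b) = sract x a + sract x b.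
Proof. by apply: val_inj; rewrite /= !ractDr. Qed.
Let sractA x a b : sract (sract x a) b = sract x (amul a b).
Proof. by apply: val_inj; rewrite /= !ractA. Qed.
Let sractZl (c : R[i]) x a : sract (c *: x) a = c *: sract x a.
Proof. by apply: val_inj; rewrite /= !ractZl. Qed.
Let sractZr (c : R[i]) x a : sract x (c *: a) = c *: sract x a.
Proof. by apply: val_inj; rewrite /= !ractZr. Qed.
Let sipDr x y z : sip x (y + z) = sip x y + sip x z.
Proof. by rewrite /sip /= !ipDr. Qed.
Let sipZr (c : R[i]) x y : sip x (c *: y) = c *: sip x y.
Proof. by rewrite /sip /= !ipZr. Qed.
Let sip_ractr x y a : sip x (sract y a) = amul (sip x y) a.
Proof. by rewrite /sip /= !ip_ractr. Qed.
Let sipC x y : sip y x = astar (sip x y).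
Proof. exact: ipC. Qed.
Let sip_pos x : apos (sip x x). Proof. exact: ip_pos. Qed.
Let sip_eq0 x : sip x x = 0 -> x = 0.
Proof. by move=> /ip_eq0 x0; apply: val_inj. Qed.

HB.instance Definition _ := isHermModule.Build R A (subm_type S)
  sractDl sractDr sractA sractZl sractZr sipDr sipZr sip_ractr sipC.
HB.instance Definition _ := isInnerProductModule.Build R A (subm_type S)
  sip_pos sip_eq0.

(* The map f with its codomain cut down to S; it is only meaningful when f
   takes its values in S.                                                     *)
Definition corestrict (T : Type) (f : T -> E) (x : T) : subm_type S :=
  insubd (0 : subm_type S) (f x).

End Submodule.

Coercion subm_type : submodule >-> Sortclass.

Section Operators.
Context (R : realType) (A : cstarAlgType R).

(* Adjoints, inverses, square roots and projections are selected by their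
   defining properties; each is 0 when no map has these properties.           *)

Section HermOperators.
Context (E F : hermModType A).

Definition adjoint_of (T : E -> F) (S : F -> E) : Prop :=
  forall x y, ip (T x) y = ip x (S y).

Definition adjointable (T : E -> F) : Prop := exists S, adjoint_of T S.

Definition adj (T : E -> F) : F -> E :=
  xget (fun=> 0) [set S : F -> E | adjoint_of T S].

Lemma adjP (T : E -> F) : adjointable T -> adjoint_of T (adj T).
Proof. by move=> [S TS]; apply: (xgetPex (fun=> 0)); exists S. Qed.

Definition opinv (T : E -> F) : F -> E :=
  xget (fun=> 0) [set S : F -> E | S \o T = idfun /\ T \o S = idfun].

End HermOperators.

Lemma ipBr (E : hermModType A) (x y z : E) : ip x (y - z) = ip x y - ip x z.
Proof. by rewrite -scaleN1r ipDr ipZr scaleN1r. Qed.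

Lemma ipBl (E : hermModType A) (x y z : E) : ip (x - y) z = ip x z - ip y z.
Proof.
rewrite ipC ipBr -scaleN1r astarD astarZ -!ipC -(scaleN1r (ip y z)).
by congr (_ + _ *: _); rewrite rmorphN rmorph1.
Qed.

(* Positivity in the C*-algebra of adjointable operators on E. *)
Definition op_pos (E : hermModType A) (T : E -> E) : Prop :=
  exists S : E -> E, adjointable S /\ T = adj S \o S.

Definition opsqrt (E : hermModType A) (T : E -> E) : E -> E :=
  xget (fun=> 0) [set B : E -> E | op_pos B /\ B \o B = T].

Definition block_op (E F : hermModType A) (T11 : E -> E) (T12 : F -> E)
    (T21 : E -> F) (T22 : F -> F) (u : E * F) : E * F :=
  (T11 u.1 + T12 u.2, T21 u.1 + T22 u.2).

Definition is_idempotent (E : hermModType A) (Q : E -> E) : Prop := Q \o Q = Q.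

Definition is_projection (E : hermModType A) (P : E -> E) : Prop :=
  adjoint_of P P /\ is_idempotent P.

(* The space L(E, F) of adjointable operators; linearity is automatic. *)
Record adjop (E F : ipModType A) := AdjOp {
  adjop_fun :> E -> F;
  adjopP : adjointable adjop_fun
}.

Section AdjOp.
Context (E F : ipModType A).

Lemma ip_ext (x y : E) : (forall z, ip z x = ip z y) -> x = y.
Proof.
move=> xy; apply/eqP; rewrite -subr_eq0; apply/eqP/ip_eq0.
by rewrite ipBr xy subrr.
Qed.

Lemma adjoint_sym (T : E -> F) (S : F -> E) :
  adjoint_of T S -> adjoint_of S T.
Proof. by move=> TS x y; rewrite ipC -TS -ipC. Qed.

Definition adjL (T : adjop E F) : adjop F E :=
  AdjOp (ex_intro _ (T : E -> F) (adjoint_sym (adjP (adjopP T)))).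

End AdjOp.

Section AdjOpLinear.
Context (E F : ipModType A) (T : adjop E F).

Lemma adjopD x y : T (x + y) = T x + T y.
Proof.
have H := adjoint_sym (adjP (adjopP T)).
by apply: ip_ext => z; rewrite ipDr -!H ipDr.
Qed.

Lemma adjopZ (c : R[i]) x : T (c *: x) = c *: T x.
Proof.
have H := adjoint_sym (adjP (adjopP T)).
by apply: ip_ext => z; rewrite ipZr -!H ipZr.
Qed.

Lemma adjop_ract x a : T (ract x a) = ract (T x) a.
Proof.
have H := adjoint_sym (adjP (adjopP T)).
by apply: ip_ext => z; rewrite ip_ractr -!H ip_ractr.
Qed.

Lemma adjop0 : T 0 = 0.
Proof. by rewrite -(scale0r 0) adjopZ scale0r. Qed.

Let range_closed : subsemimod_closed [pred y | `[< exists x, T x = y >]].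
Proof.
split; first split.
- by apply/asboolP; exists 0; exact: adjop0.
- move=> _ _ /asboolP[x <-] /asboolP[y <-].
  by apply/asboolP; exists (x + y); rewrite adjopD.
- by move=> c _ /asboolP[x <-]; apply/asboolP; exists (c *: x); rewrite adjopZ.
Qed.

Let range_ract y a : y \in [pred y | `[< exists x, T x = y >]] ->
  ract y a \in [pred y | `[< exists x, T x = y >]].
Proof.
by move=> /asboolP[x <-]; apply/asboolP; exists (ract x a); rewrite adjop_ract.
Qed.

Definition rangeL : submodule F := Submodule range_closed range_ract.

Let null_closed : subsemimod_closed [pred x | T x == 0].
Proof.
split; first split.
- by rewrite inE adjop0.
- by move=> x y /eqP x0 /eqP y0; rewrite inE adjopD x0 y0 addr0.
- by move=> c x /eqP x0; rewrite inE adjopZ x0 scaler0.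
Qed.

Let null_ract x a : x \in [pred x | T x == 0] ->
  ract x a \in [pred x | T x == 0].
Proof.
move=> /eqP x0; rewrite inE adjop_ract x0 -(scale0r (0 : F)) ractZl.
by rewrite !scale0r.
Qed.

Definition nullL : submodule E := Submodule null_closed null_ract.

End AdjOpLinear.

Section OneMinus.
Context (E : ipModType A) (T : adjop E E).

Let one_minus_adjointable : adjointable (idfun \- T : E -> E).
Proof.
by exists (idfun \- adj T) => x y /=; rewrite ipBl ipBr (adjP (adjopP T)).
Qed.

Definition one_minusL : adjop E E := AdjOp one_minus_adjointable.

End OneMinus.

(* Relevant when S is orthogonally complemented. *)
Definition proj_onto (E : ipModType A) (S : submodule E) : E -> E :=
  xget (fun=> 0) [set P : E -> E | is_projection P /\ range P = [set` subm_pred S]].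

Section MatchedProjection.
Context (H : hilbertModType A) (Q : adjop H H).

Local Notation RQ := (rangeL Q).
Local Notation NQ := (nullL (adjL Q)).
Local Notation PRQ := (proj_onto RQ).

Definition mp_U : H -> RQ * NQ :=
  fun h => (corestrict RQ PRQ h, corestrict NQ (idfun \- PRQ) h).

Definition mp_A : NQ -> RQ := corestrict RQ ((Q \- PRQ) \o val).

Definition mp_B : RQ -> RQ := opsqrt ((mp_A \o adj mp_A) \+ idfun).

Definition mp_matrix : RQ * NQ -> RQ * NQ :=
  let B := mp_B in
  block_op
    ((B \+ idfun) \o opinv B)  (opinv B \o mp_A)
    (adj mp_A \o opinv B)      (adj mp_A \o opinv (B \o (B \+ idfun)) \o mp_A).

Definition matched_projection : H -> H :=
  if `[< is_projection Q >] then adjop_fun Q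
  else adj mp_U \o (2^-1 \*: mp_matrix) \o mp_U.

End MatchedProjection.

End Operators.

(* Main.v *)
Require Import Defs.
From HB Require Import structures.
From mathcomp Require Import all_boot all_order all_algebra.
From mathcomp Require Import all_classical all_reals all_analysis.
From mathcomp Require Import ring lra.

Set Implicit Arguments.
Unset Strict Implicit.
Unset Printing Implicit Defensive.

Import Order.TTheory GRing.Theory Num.Theory.
Import numFieldNormedType.Exports.

Local Open Scope classical_set_scope.
Local Open Scope ring_scope.
Local Open Scope complex_scope.

(* Write W = Q + Q^* - 1 for the idempotent Q. Then 2 m(Q) - 1 = W |W|^-1 is the
   sign of the self-adjoint invertible operator W, and replacing Q by 1 - Q
   replaces W by - W.

   No order theory of the C*-algebra A is needed. The square roots come from
   the contraction T |-> (X + T^2) / 2. The bound |1 - 2 k^2| <= 1 for a small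
   self-adjoint k holds because k + i sqrt(1 - k^2) is unitary; with k a multiple
   of i (Q - Q^* ) it shows that W^2 = 1 + (i (Q - Q^* ))^2 is invertible and has
   a positive square root |W|. The square root B in the definition of m(Q) is
   only known to be of the form S^* S; it is the restriction of |W| because a
   positive square root is unique, which reduces to: b^* b = - k^2 with k
   self-adjoint forces k = 0.                                                 *)

(** * Real-valued norms and geometric limits *)

Section RealNorm.
Context (R : realType).

Definition nrm (V : normedModType R[i]) (x : V) : R := complex.Re `|x|.

Section NormedMod.
Context (V : normedModType R[i]).
Implicit Types x y : V.

Lemma nrmE x : `|x| = (nrm x)%:C.
Proof. by rewrite /nrm RRe_real // ger0_real. Qed.

Lemma nrm_ge0 x : 0 <= nrm x.
Proof. by rewrite -ler0c -nrmE. Qed.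

Lemma nrm0 : nrm (0 : V) = 0.
Proof. by rewrite /nrm normr0. Qed.

Lemma nrm_eq0 x : nrm x = 0 -> x = 0.
Proof. by move=> x0; apply/normr0_eq0; rewrite nrmE x0. Qed.

Lemma nrmN x : nrm (- x) = nrm x.
Proof. by rewrite /nrm normrN. Qed.

Lemma nrmBC x y : nrm (x - y) = nrm (y - x).
Proof. by rewrite -nrmN opprB. Qed.

Lemma nrmMn x n : nrm (x *+ n) = nrm x *+ n.
Proof. by rewrite /nrm normrMn raddfMn. Qed.

Lemma nrmD x y : nrm (x + y) <= nrm x + nrm y.
Proof. by rewrite -lecR rmorphD /= -!nrmE ler_normD. Qed.

Lemma nrmB x y : nrm (x - y) <= nrm x + nrm y.
Proof. by rewrite -(nrmN y) nrmD. Qed.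

Lemma nrmBD z x y : nrm (x - y) <= nrm (x - z) + nrm (z - y).
Proof. by rewrite -{1}(subrK z x) -addrA nrmD. Qed.

End NormedMod.

Lemma nrmZ (V : normedModType R[i]) (t : R) (x : V) :
  nrm (t%:C *: x) = `|t| * nrm x.
Proof.
rewrite /nrm normrZ normc_def /= expr0n addr0 sqrtr_sqr.
by rewrite [`|x|]nrmE -rmorphM.
Qed.

Lemma nrmZi (V : normedModType R[i]) (x : V) : nrm ('i *: x) = nrm x.
Proof.
by rewrite /nrm normrZ normc_def /= expr0n add0r expr1n sqrtr1 mul1r.
Qed.

Section Complete.
Context (V : completeNormedModType R[i]).

Lemma nrm_geometric_tail (u : nat -> V) (c r : R) :
    0 <= r < 1 -> (forall n, nrm (u n.+1 - u n) <= c * r ^+ n) ->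
  forall n m, nrm (u (n + m)%N - u n) <= c * r ^+ n / (1 - r).
Proof.
move=> /andP[r0 r1] cu n m.
have c0 : 0 <= c by have := le_trans (nrm_ge0 _) (cu 0%N); rewrite expr0 mulr1.
(* The factor [1 - r ^+ m] is the exact partial geometric sum; it makes the induction close. *)
have : nrm (u (n + m)%N - u n) <= c * r ^+ n * (1 - r ^+ m) / (1 - r).
  elim: m => [|m IH]; first by rewrite addn0 subrr nrm0 expr0 subrr mulr0 mul0r.
  rewrite addnS; apply: (le_trans (nrmBD (u (n + m)%N) _ _)).
  apply: (le_trans (lerD (cu _) IH)).
  rewrite -[X in X + _](@mulfK _ (1 - r)) ?subr_eq0 ?gt_eqF // -mulrDl.
  rewrite ler_pM2r ?invr_gt0 ?subr_gt0 // exprD exprS.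
  by rewrite le_eqVlt; apply/predU1P; left; ring.
move=> /le_trans; apply.
rewrite ler_pM2r ?invr_gt0 ?subr_gt0 // ler_piMr ?mulr_ge0 ?exprn_ge0 //.
by rewrite gerBl exprn_ge0.
Qed.

Lemma geometric_small (c r e : R) : 0 <= r < 1 -> 0 < e ->
  exists N, forall n, (N <= n)%N -> c * r ^+ n < e.
Proof.
move=> /andP[r0 r1] e0.
have /cvgrPdist_lt/(_ e e0)[N _ NP] : (fun n => c * r ^+ n) @ \oo --> (0 : R).
  rewrite -(mulr0 c); by apply: cvgMl_tmp; apply: cvg_expr; rewrite ger0_norm.
exists N => n /NP /=; rewrite sub0r normrN => /(le_lt_trans _); apply.
exact: ler_norm.
Qed.

(** The explicit rate lets pointwise limits of operators inherit bounds that are uniform in the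
    vector. *)
Lemma geometric_cvg (u : nat -> V) (c r : R) :
    0 <= r < 1 -> (forall n, nrm (u n.+1 - u n) <= c * r ^+ n) ->
  exists l, forall n, nrm (l - u n) <= c * r ^+ n / (1 - r).
Proof.
move=> r01 cu; have tail := nrm_geometric_tail r01 cu.
have small := geometric_small (c / (1 - r)) r01.
have /cauchy_cvg ul : cauchy (u @ \oo).
  apply/cauchy_exP => e e0.
  have [e1 eE] : exists e1, e = e1%:C.
    by exists (complex.Re e); rewrite RRe_real // gtr0_real.
  rewrite eE ltcR in e0 *; have [N NP] := small _ e0.
  exists (u N); exists N => // n /= Nn; rewrite -ball_normE /=.
  rewrite nrmE ltcR nrmBC -(subnKC Nn) (le_lt_trans (tail _ _)) //.
  by rewrite mulrAC NP.
exists (lim (u @ \oo)) => n; apply/ler_addgt0Pr => e e0.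
have /cvgrPdist_lt/(_ e%:C) : u @ \oo --> lim (u @ \oo) by [].
rewrite ltcR => /(_ e0)[N _ /(_ (n + N)%N (leq_addl _ _))/=].
rewrite nrmE ltcR => /ltW lu.
apply: (le_trans (nrmBD (u (n + N)%N) _ _)); rewrite addrC.
exact: lerD (tail _ _) lu.
Qed.

End Complete.
End RealNorm.

(** * Forms and bounded operators *)

Lemma conjc_i (R : realType) : conjc 'i%C = - 'i%C :> R[i].
Proof. by apply/eqP; rewrite eq_complex /= oppr0 !eqxx. Qed.

Section Form.
Context (R : realType) (A : cstarAlgType R).

Section HermModule.
Context (E : hermModType A).
Implicit Types (x y z : E) (c : R[i]).

Lemma ipDl x y z : ip (x + y) z = ip x z + ip y z.
Proof. by rewrite ipC ipDr astarD -!ipC. Qed.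

Lemma ipZl c x y : ip (c *: x) y = conjc c *: ip x y.
Proof. by rewrite ipC ipZr astarZ -ipC. Qed.

Lemma ip0r x : ip x (0 : E) = 0.
Proof. by rewrite -(scale0r (0 : E)) ipZr scale0r. Qed.

Lemma ip0l x : ip (0 : E) x = 0.
Proof. by rewrite -(scale0r (0 : E)) ipZl rmorph0 scale0r. Qed.

Lemma ipNr x y : ip x (- y) = - ip x y.
Proof. by rewrite -scaleN1r ipZr scaleN1r. Qed.

Lemma ipNl x y : ip (- x) y = - ip x y.
Proof. by rewrite ipC ipNr -scaleN1r astarZ rmorphN rmorph1 scaleN1r -ipC. Qed.

Lemma polarization x y :
  ip (x + y) (x + y) - ip (x - y) (x - y)
  - 'i%C *: (ip (x + 'i%C *: y) (x + 'i%C *: y) - ip (x - 'i%C *: y) (x - 'i%C *: y))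
  = ip x y *+ 4.
Proof.
rewrite !(ipDl, ipDr, ipNl, ipNr, ipZl, ipZr, scalerN, scaleNr, conjc_i).
rewrite !opprK.
set a := ip x y; set b := ip y x; set p := ip x x; set q := ip y y.
have iiN (u : A) : 'i%C *: ('i%C *: u) = - u.
  by rewrite scalerA -expr2 sqr_i scaleN1r.
rewrite [in X in _ - X](scalerDr 'i%C b) [in X in _ - X](scalerBr 'i%C b) !iiN.
set c := 'i%C *: a; set d := 'i%C *: b.
rewrite [X in X - _](_ : _ = (a + b) *+ 2); last first.
  rewrite !opprB (AC ((2*2)*(2*2)) ((1*8)*(4*6)*((2*3)*(7*5)))) /=.
  by rewrite !subrr !add0r -mulr2n.
rewrite [X in 'i%C *: X](_ : _ = (c - d) *+ 2); last first.
  rewrite !opprD !opprK (AC ((2*2)*(2*2)) ((1*5)*(4*8)*((2*3)*(6*7)))) /=.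
  by rewrite !subrr !add0r -mulr2n.
rewrite -scalerMnr scalerBr !iiN -mulrnBl opprD !opprK addrACA subrr addr0.
by rewrite -mulr2n -mulrnA.
Qed.

End HermModule.

Lemma nrm_ip (H : hilbertModType A) (x : H) : nrm (ip x x) = nrm x ^+ 2.
Proof.
by apply: complexI; rewrite rmorphXn /= -!nrmE norm_ip.
Qed.

Section HilbertModule.
Context (H : hilbertModType A).

(* Polarization does not give the optimal constant 1 of the Cauchy-Schwarz
   inequality, but needs no positivity in [A].                                *)
Lemma nrm_ip_le (x y : H) : nrm (ip x y) <= 4 * nrm x * nrm y.
Proof.
(* On unit vectors each of the four squares in [polarization] has norm at most 2^2, so four times
   the form has norm at most 16. *)
have le1 (u v : H) : nrm u = 1 -> nrm v = 1 -> nrm (ip u v) <= 4.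
  move=> u1 v1.
  have qle (w : H) : nrm w <= 2 -> nrm (ip w w) <= 4.
    by move=> w2; rewrite nrm_ip; have := nrm_ge0 w; nra.
  rewrite -(ler_pM2r (_ : 0 < 4%:R)) // mulr_natr -nrmMn -polarization.
  rewrite (le_trans (nrmB _ _)) // nrmZi.
  apply: (le_trans (lerD (nrmB _ _) (nrmB _ _))).
  rewrite (_ : 4 * 4 = 4 + 4 + (4 + 4)); last by ring.
  have uD (w : H) : nrm w = 1 -> nrm (u + w) <= 2.
    by move=> w1; apply: (le_trans (nrmD _ _)); rewrite u1 w1.
  by rewrite !lerD // qle // uD // ?nrmN ?nrmZi.
have [->|x0] := eqVneq x 0; first by rewrite ip0l !nrm0 mulr0 mul0r.
have [->|y0] := eqVneq y 0; first by rewrite ip0r !nrm0 mulr0.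
have pos (v : H) : v != 0 -> 0 < nrm v.
  by move=> v0; rewrite lt_neqAle nrm_ge0 andbT eq_sym; apply: contra_neq v0 => /nrm_eq0.
have := le1 ((nrm x)^-1%:C *: x) ((nrm y)^-1%:C *: y).
rewrite !nrmZ !ger0_norm ?invr_ge0 ?nrm_ge0 // !mulVf ?gt_eqF ?pos //.
move=> /(_ erefl erefl).
rewrite ipZl ipZr conjc_real !nrmZ !ger0_norm ?invr_ge0 ?nrm_ge0 //.
by rewrite mulrA -invfM ler_pdivrMl ?mulr_gt0 ?pos // mulrC mulrA.
Qed.

(* Gliding hump: if [T] is unbounded, pick unit vectors [z n] with [T (z n)]
   large and signs such that [l = \sum_n (+/-) 9^-n y n], with [y n] the
   normalisation of [T (z n)], keeps [ip (T (z n)) l = ip (z n) (adj T l)]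
   unbounded, although [nrm (z n) = 1].                                       *)
Lemma adjop_bounded (T : adjop H H) :
  exists2 c, 0 <= c & forall x, nrm (T x) <= c * nrm x.
Proof.
apply: contrapT => unbounded.
pose r : R := 9^-1.
have r01 : 0 <= r < 1 by rewrite /r; lra.
(* If no such [z] existed for some [n], then [2 n 9^n] would bound [T]. *)
have /choice[z zP] n : exists z, nrm z = 1 /\ 2 * n%:R < r ^+ n * nrm (T z).
  apply: contrapT => nz; apply: unbounded; exists (2 * n%:R * 9 ^+ n) => [|x].
    by rewrite !mulr_ge0 // exprn_ge0.
  rewrite leNgt; apply/negP => Tx; apply: nz.
  have x0 : 0 < nrm x.
    rewrite lt_neqAle nrm_ge0 andbT eq_sym; apply: contraPneq Tx => /nrm_eq0 ->.
    by rewrite adjop0 !nrm0 mulr0 ltxx.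
  exists ((nrm x)^-1%:C *: x); split.
    by rewrite nrmZ ger0_norm ?invr_ge0 ?nrm_ge0 // mulVf ?gt_eqF.
  rewrite adjopZ nrmZ ger0_norm ?invr_ge0 ?nrm_ge0 // /r exprVn mulrCA.
  rewrite ltr_pdivlMl // ltr_pdivlMl ?exprn_gt0 //; apply: le_lt_trans Tx.
  by rewrite le_eqVlt; apply/predU1P; left; ring.
have Tz0 n : 0 < nrm (T (z n)).
  rewrite lt_neqAle nrm_ge0 andbT eq_sym; apply/eqP => Tz.
  have [_] := zP n; rewrite Tz mulr0 ltNge mulr_ge0 //.
pose y n : H := (r ^+ n / nrm (T (z n)))%:C *: T (z n).
have ny n : nrm (y n) = r ^+ n.
  rewrite nrmZ ger0_norm ?divfK ?gt_eqF // divr_ge0 ?nrm_ge0 //.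
  by rewrite exprn_ge0 // /r.
have Ty n : nrm (ip (T (z n)) (y n)) = r ^+ n * nrm (T (z n)).
  rewrite ipZr nrmZ nrm_ip ger0_norm; last first.
    by rewrite divr_ge0 ?nrm_ge0 // exprn_ge0 // /r.
  by rewrite expr2 mulrA divfK // gt_eqF.
(* The pairings with [x + y n] and [x - y n] differ by twice the pairing with [y n], so one of them
   is at least as large as the latter. *)
have sign n x : exists x', nrm (x' - x) = r ^+ n /\
    r ^+ n * nrm (T (z n)) <= nrm (ip (T (z n)) x').
  have [xy|xy] := lerP (r ^+ n * nrm (T (z n))) (nrm (ip (T (z n)) (x + y n))).
    by exists (x + y n); rewrite addrC addKr ny.
  exists (x - y n); rewrite addrC addKr nrmN ny; split=> //.
  have := nrmB (ip (T (z n)) (x + y n)) (ip (T (z n)) (x - y n)).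
  rewrite -ipBr opprD opprK addrACA subrr add0r -mulr2n -scaler_nat.
  rewrite -(rmorph_nat (real_complex R)) ipZr nrmZ normr_nat Ty.
  by move: xy; lra.
have /choice[g gP] n : exists g, forall x, nrm (g x - x) = r ^+ n /\
    r ^+ n * nrm (T (z n)) <= nrm (ip (T (z n)) (g x)).
  by have /choice[g gP] := sign n; exists g.
pose fix u n : H := if n is n'.+1 then g n' (u n') else 0.
have [|l lP] := @geometric_cvg _ _ u 1 r r01.
  by move=> n; rewrite mul1r /= (gP n _).1.
have lz n : n%:R <= 4 * nrm (adj T l).
  have [z1 zn] := zP n; have [_ gn] := gP n (u n).
  have := nrm_ip_le (z n) (adj T l); rewrite -(adjP (adjopP T)) z1.
  have := nrm_ip_le (T (z n)) (l - u n.+1).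
  have := nrmBD (ip (T (z n)) l) (ip (T (z n)) (u n.+1)) 0.
  rewrite !subr0 nrmBC -ipBr /=.
  (* With ratio 1/9 the increments after [u n.+1] add up to at most [r^n / 8]. The factor 4 of
     [nrm_ip_le] then costs half of the hump, and the other half exceeds [n]. *)
  have : 4 * nrm (T (z n)) * nrm (l - u n.+1) <= r ^+ n * nrm (T (z n)) / 2.
    have -> : r ^+ n * nrm (T (z n)) / 2 = 4 * nrm (T (z n)) * (r ^+ n / 8) by field.
    rewrite ler_wpM2l ?mulr_ge0 ?nrm_ge0 //; apply: (le_trans (lP n.+1)).
    have -> : 1 - r = 8 / 9 by rewrite /r; lra.
    by rewrite exprS {1}/r; lra.
  by move: gn zn => /=; set t := r ^+ n * _ => *; lra.
have := archi_boundP (_ : 0 <= 4 * nrm (adj T l)).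
by rewrite mulr_ge0 ?nrm_ge0 // => /(_ isT); rewrite ltNge lz.
Qed.

End HilbertModule.
End Form.

(** * The algebra of adjointable operators *)

Section OperatorModule.
Context (R : realType) (A : cstarAlgType R) (E F : ipModType A).
Implicit Types T S : adjop E F.

Lemma adjop_eq T S : T =1 S -> T = S.
Proof.
case: T S => [f fP] [g gP] /= /funext fg; subst g.
by rewrite (Prop_irrelevance fP gP).
Qed.

Lemma ip_adj T x y : ip (T x) y = ip x (adjL T y).
Proof. exact: (adjP (adjopP T)). Qed.

HB.instance Definition _ := gen_eqMixin (adjop E F).
HB.instance Definition _ := gen_choiceMixin (adjop E F).

Let zero_adjointable : adjointable (fun _ : E => 0 : F).
Proof. by exists (fun=> 0) => x y; rewrite ip0l ip0r. Qed.

Let opp_adjointable T : adjointable (fun x => - T x).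
Proof. by exists (fun y => - adjL T y) => x y; rewrite ipNl ipNr ip_adj. Qed.

Let add_adjointable T S : adjointable (fun x => T x + S x).
Proof.
by exists (fun y => adjL T y + adjL S y) => x y; rewrite ipDl ipDr !ip_adj.
Qed.

Let scale_adjointable (c : R[i]) T : adjointable (fun x => c *: T x).
Proof.
exists (fun y => conjc c *: adjL T y) => x y.
by rewrite ipZl ipZr ip_adj.
Qed.

Let addA : associative (fun T S => AdjOp (add_adjointable T S)).
Proof. by move=> T S U; apply: adjop_eq => x /=; rewrite addrA. Qed.
Let addC : commutative (fun T S => AdjOp (add_adjointable T S)).
Proof. by move=> T S; apply: adjop_eq => x /=; rewrite addrC. Qed.
Let add0 :
  left_id (AdjOp zero_adjointable) (fun T S => AdjOp (add_adjointable T S)).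
Proof. by move=> T; apply: adjop_eq => x /=; rewrite add0r. Qed.
Let addN : left_inverse (AdjOp zero_adjointable)
  (fun T => AdjOp (opp_adjointable T))
  (fun T S => AdjOp (add_adjointable T S)).
Proof. by move=> T; apply: adjop_eq => x /=; rewrite addNr. Qed.

HB.instance Definition _ :=
  GRing.isZmodule.Build (adjop E F) addA addC add0 addN.

Lemma add_adjopE T S x : (T + S) x = T x + S x. Proof. by []. Qed.
Lemma opp_adjopE T x : (- T) x = - T x. Proof. by []. Qed.
Lemma sub_adjopE T S x : (T - S) x = T x - S x. Proof. by []. Qed.
Lemma zero_adjopE x : (0 : adjop E F) x = 0. Proof. by []. Qed.

Let scaleA (a b : R[i]) T : AdjOp (scale_adjointable a (AdjOp (scale_adjointable b T)))
  = AdjOp (scale_adjointable (a * b) T).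
Proof. by apply: adjop_eq => x /=; rewrite scalerA. Qed.
Let scale1 : left_id 1 (fun c T => AdjOp (scale_adjointable c T)).
Proof. by move=> T; apply: adjop_eq => x /=; rewrite scale1r. Qed.
Let scaleDr : right_distributive (fun c T => AdjOp (scale_adjointable c T)) +%R.
Proof. by move=> c T S; apply: adjop_eq => x /=; rewrite scalerDr. Qed.
Let scaleDl T :
  {morph (fun c => AdjOp (scale_adjointable c T)) : a b / a + b}.
Proof. by move=> a b; apply: adjop_eq => x /=; rewrite scalerDl. Qed.

HB.instance Definition _ := GRing.Zmodule_isLmodule.Build R[i] (adjop E F)
  scaleA scale1 scaleDr scaleDl.

Lemma scale_adjopE (c : R[i]) T x : (c *: T) x = c *: T x. Proof. by []. Qed.

End OperatorModule.

Section OperatorRing.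
Context (R : realType) (A : cstarAlgType R) (E : ipModType A).
Implicit Types T S U : adjop E E.

Let id_adjointable : adjointable (fun x : E => x).
Proof. by exists idfun. Qed.

Let comp_adjointable T S : adjointable (fun x => T (S x)).
Proof. by exists (fun y => adjL S (adjL T y)) => x y; rewrite !ip_adj. Qed.

Let mulA : associative (fun T S => AdjOp (comp_adjointable T S)).
Proof. by move=> T S U; apply: adjop_eq. Qed.
Let mul1 :
  left_id (AdjOp id_adjointable) (fun T S => AdjOp (comp_adjointable T S)).
Proof. by move=> T; apply: adjop_eq. Qed.
Let mulr1 :
  right_id (AdjOp id_adjointable) (fun T S => AdjOp (comp_adjointable T S)).
Proof. by move=> T; apply: adjop_eq. Qed.
Let mulDl :
  left_distributive (fun T S => AdjOp (comp_adjointable T S)) +%R.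
Proof. by move=> T S U; apply: adjop_eq. Qed.
Let mulDr :
  right_distributive (fun T S => AdjOp (comp_adjointable T S)) +%R.
Proof. by move=> T S U; apply: adjop_eq => x /=; rewrite adjopD. Qed.

HB.instance Definition _ := GRing.Zmodule_isPzRing.Build (adjop E E)
  mulA mul1 mulr1 mulDl mulDr.

Lemma mul_adjopE T S x : (T * S) x = T (S x). Proof. by []. Qed.
Lemma one_adjopE x : (1 : adjop E E) x = x. Proof. by []. Qed.

Lemma one_minusLE T : one_minusL T = 1 - T.
Proof. exact: adjop_eq. Qed.

Lemma scale_mul_adjop (c : R[i]) T S : (c *: T) * S = c *: (T * S).
Proof. exact: adjop_eq. Qed.

Lemma mul_scale_adjop (c : R[i]) T S : T * (c *: S) = c *: (T * S).
Proof. by apply: adjop_eq => x; rewrite scale_adjopE !mul_adjopE adjopZ. Qed.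

Lemma adjL_uniq T S : (forall x y, ip (T x) y = ip x (S y)) -> adjL T = S.
Proof.
by move=> TS; apply: adjop_eq => y; apply: ip_ext => x; rewrite -ip_adj TS.
Qed.

Lemma adjLK T : adjL (adjL T) = T.
Proof. by apply: adjL_uniq => x y; rewrite ipC -ip_adj -ipC. Qed.

Lemma adjLD T S : adjL (T + S) = adjL T + adjL S.
Proof.
by apply: adjL_uniq => x y; rewrite !add_adjopE ipDl ipDr -!ip_adj.
Qed.

Lemma adjLN T : adjL (- T) = - adjL T.
Proof. by apply: adjL_uniq => x y; rewrite !opp_adjopE ipNl ipNr -ip_adj. Qed.

Lemma adjLB T S : adjL (T - S) = adjL T - adjL S.
Proof. by rewrite adjLD adjLN. Qed.

Lemma adjLZ (c : R[i]) T : adjL (c *: T) = conjc c *: adjL T.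
Proof.
by apply: adjL_uniq => x y; rewrite !scale_adjopE ipZl ipZr -ip_adj.
Qed.

Lemma adjLZr (c : R) T : adjL (c%:C *: T) = c%:C *: adjL T.
Proof. by rewrite adjLZ conjc_real. Qed.

Lemma adjLM T S : adjL (T * S) = adjL S * adjL T.
Proof. by apply: adjL_uniq => x y; rewrite !mul_adjopE -!ip_adj. Qed.

Lemma adjL1 : adjL (1 : adjop E E) = 1.
Proof. exact: adjL_uniq. Qed.

Lemma adjL0 : adjL (0 : adjop E E) = 0.
Proof. by apply: adjL_uniq => x y; rewrite !zero_adjopE ip0l ip0r. Qed.

Lemma adjL_mul_eq0 T : adjL T * T = 0 -> T = 0.
Proof.
move=> TT; apply: adjop_eq => x; apply: ip_eq0.
by rewrite ip_adj -mul_adjopE TT ip0r.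
Qed.

Definition selfadj T : Prop := adjL T = T.

Lemma selfadj0 : selfadj 0. Proof. exact: adjL0. Qed.
Lemma selfadj1 : selfadj 1. Proof. exact: adjL1. Qed.

Lemma selfadjD T S : selfadj T -> selfadj S -> selfadj (T + S).
Proof. by move=> sT sS; rewrite /selfadj adjLD sT sS. Qed.

Lemma selfadjB T S : selfadj T -> selfadj S -> selfadj (T - S).
Proof. by move=> sT sS; rewrite /selfadj adjLB sT sS. Qed.

Lemma selfadjZ (c : R) T : selfadj T -> selfadj (c%:C *: T).
Proof. by move=> sT; rewrite /selfadj adjLZr sT. Qed.

Lemma selfadjM T S :
  selfadj T -> selfadj S -> GRing.comm T S -> selfadj (T * S).
Proof. by move=> sT sS TS; rewrite /selfadj adjLM sT sS. Qed.

End OperatorRing.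

(** * Operator bounds and fixed points of contractions *)

Section OperatorNorm.
Context (R : realType) (A : cstarAlgType R) (H : hilbertModType A).
Implicit Types (T S : adjop H H) (c d r : R).

(** Bounds stand in for the operator norm, so that no supremum has to be formed. *)
Definition opbound T c : Prop := forall x, nrm (T x) <= c * nrm x.

Lemma opbound_exists T : exists2 c, 0 <= c & opbound T c.
Proof. exact: adjop_bounded. Qed.

Lemma opbound_le T c d : c <= d -> opbound T c -> opbound T d.
Proof. by move=> cd Tc x; rewrite (le_trans (Tc x)) // ler_wpM2r ?nrm_ge0. Qed.

Lemma opbound0 : opbound 0 0.
Proof. by move=> x; rewrite zero_adjopE nrm0 mul0r. Qed.

Lemma opbound1 : opbound 1 1.
Proof. by move=> x; rewrite one_adjopE mul1r. Qed.

Lemma opboundN T c : opbound T c -> opbound (- T) c.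
Proof. by move=> Tc x; rewrite opp_adjopE nrmN. Qed.

Lemma opboundD T S c d : opbound T c -> opbound S d -> opbound (T + S) (c + d).
Proof.
by move=> Tc Sd x; rewrite add_adjopE (le_trans (nrmD _ _)) // mulrDl lerD.
Qed.

Lemma opboundB T S c d : opbound T c -> opbound S d -> opbound (T - S) (c + d).
Proof. by move=> Tc /opboundN; exact: opboundD. Qed.

Lemma opboundZ a T c : opbound T c -> opbound (a%:C *: T) (`|a| * c).
Proof. by move=> Tc x; rewrite scale_adjopE nrmZ -mulrA ler_wpM2l. Qed.

Lemma opboundM T S c d :
  0 <= c -> opbound T c -> opbound S d -> opbound (T * S) (c * d).
Proof.
by move=> c0 Tc Sd x; rewrite mul_adjopE (le_trans (Tc _)) // -mulrA ler_wpM2l.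
Qed.

Lemma opbound_isometry T : adjL T * T = 1 -> opbound T 1.
Proof.
move=> TT x; rewrite mul1r -(ler_pXn2r (_ : 0 < 2)%N) ?nnegrE ?nrm_ge0 //.
by rewrite -!nrm_ip ip_adj -mul_adjopE TT.
Qed.

Lemma geometric_le (a b c r : R) : 0 <= r < 1 ->
  (forall n, a <= b + c * r ^+ n) -> a <= b.
Proof.
move=> r01 abc; apply/ler_addgt0Pr => e /(geometric_small c r01)[N cN].
by rewrite (le_trans (abc N)) // lerD2l ltW // cN.
Qed.

Lemma geometric_eq0 (V : normedModType R[i]) (a : V) c r : 0 <= r < 1 ->
  (forall n, nrm a <= c * r ^+ n) -> a = 0.
Proof.
move=> r01 ac; apply/nrm_eq0/eqP; rewrite eq_le nrm_ge0 andbT.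
by apply: (geometric_le r01) => n; rewrite add0r; exact: ac.
Qed.

Lemma opbound_geometric_eq0 T c r : 0 <= r < 1 ->
  (forall n, opbound T (c * r ^+ n)) -> T = 0.
Proof.
move=> r01 Tc; apply: adjop_eq => x.
apply: (@geometric_eq0 _ _ (c * nrm x) r r01) => n.
by rewrite mulrAC; exact: Tc.
Qed.

(* The class of operators in which the fixed point is sought is closed under
   norm limits, so it does not matter that no topology is put on the ring of
   operators.                                                                 *)
Lemma contraction_fixpoint (X : adjop H H) (rho r : R)
    (Phi : adjop H H -> adjop H H)
    (C := fun T => [/\ selfadj T, opbound T rho &
                     forall Z, GRing.comm Z X -> GRing.comm Z T]) :
    0 <= rho -> 0 <= r < 1 -> (forall T, C T -> C (Phi T)) ->
    (forall T S d, C T -> C S -> 0 <= d -> opbound (T - S) d ->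
       opbound (Phi T - Phi S) (r * d)) ->
  exists2 T, C T & Phi T = T.
Proof.
move=> rho0 r01 PhiC contr; have r0 : 0 <= r by case/andP: r01.
have C0 : C 0.
  split; [exact: selfadj0 | exact: opbound_le opbound0 |].
  by move=> Z _; rewrite /GRing.comm mulr0 mul0r.
pose u n := iter n Phi 0.
have uC n : C (u n) by elim: n => //= n; exact: PhiC.
have step n : opbound (u n.+1 - u n) (rho * r ^+ n).
  elim: n => [|n IH]; last first.
    rewrite exprS mulrCA; apply: (contr (u n.+1) (u n)) => //.
    by rewrite mulr_ge0 ?exprn_ge0.
  by rewrite subr0 expr0 mulr1; have [] := uC 1%N.
have /choice[L LP] x : exists l, forall n,
    nrm (l - u n x) <= rho * nrm x * r ^+ n / (1 - r).
  apply: geometric_cvg => // n; rewrite -sub_adjopE (le_trans (step n x)) //.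
  by rewrite mulrAC.
(* The pointwise limit inherits symmetry from the iterates; being its own adjoint, it is an element
   of [adjop H H]. *)
have Lsym x y : ip (L x) y = ip x (L y).
  apply/eqP; rewrite -subr_eq0; apply/eqP.
  apply: (@geometric_eq0 _ _ (8 * (rho * nrm x * nrm y / (1 - r))) r r01) => n.
  have [us _ _] := uC n.
  have -> : ip (L x) y - ip x (L y) = ip (L x - u n x) y - ip x (L y - u n y).
    by rewrite ipBl ipBr ip_adj us opprB addrA subrK.
  rewrite (le_trans (nrmB _ _)) // (le_trans (lerD (nrm_ip_le _ _) (nrm_ip_le _ _))) //.
  have := ler_wpM2r (nrm_ge0 y) (LP x n); have := ler_wpM2l (nrm_ge0 x) (LP y n).
  by move: (nrm (L x - _)) (nrm (L y - _)) ((1 - r)^-1) => a b c; lra.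
pose T : adjop H H := AdjOp (ex_intro _ L Lsym).
have d0 n : 0 <= rho * r ^+ n / (1 - r).
  rewrite divr_ge0 ?mulr_ge0 ?exprn_ge0 // subr_ge0 ltW //.
  by case/andP: r01.
have Tu n : opbound (T - u n) (rho * r ^+ n / (1 - r)).
  move=> x; rewrite sub_adjopE (le_trans (LP x n)) // le_eqVlt; apply/predU1P.
  by left; ring.
have CT : C T.
  split; first exact: adjL_uniq.
  - move=> x; apply: (@geometric_le _ _ (rho / (1 - r) * nrm x) r r01) => n.
    have [_ un _] := uC n.
    rewrite -(subrK (u n) T) add_adjopE (le_trans (nrmD _ _)) // addrC lerD //.
    apply: (le_trans (Tu n x)); rewrite le_eqVlt; apply/predU1P.
    by left; ring.
  - move=> Z ZX; apply/eqP; rewrite -subr_eq0; apply/eqP.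
    have [z z0 Zz] := opbound_exists Z.
    apply: (@opbound_geometric_eq0 _ (2 * z * rho / (1 - r)) r r01) => n.
    have [_ _ /(_ Z ZX) uZ] := uC n.
    (* The iterate commutes with [Z], so only its distance to [T] enters the commutator. *)
    have -> : Z * T - T * Z = Z * (T - u n) - (T - u n) * Z.
      by rewrite mulrBr mulrBl uZ opprB addrA subrK.
    apply: opbound_le (opboundB (opboundM z0 Zz (Tu n)) (opboundM (d0 n) (Tu n) Zz)).
    by rewrite le_eqVlt; apply/predU1P; left; ring.
exists T => //; apply/eqP; rewrite -subr_eq0; apply/eqP.
apply: (@opbound_geometric_eq0 _ (2 * rho * r / (1 - r)) r r01) => n.
have -> : Phi T - T = (Phi T - Phi (u n)) - (T - u n.+1).
  by rewrite opprB addrA subrK.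
apply: opbound_le (opboundB (contr _ _ _ CT (uC n) (d0 n) (Tu n)) (Tu n.+1)).
by rewrite exprS le_eqVlt; apply/predU1P; left; ring.
Qed.

End OperatorNorm.

Arguments selfadj1 {R A E}.
Arguments opbound1 {R A H}.
#[global] Hint Resolve selfadj1 opbound1 : core.

(** * Square roots and positivity *)

Section FunctionalCalculus.
Context (R : realType) (A : cstarAlgType R) (H : hilbertModType A).
Implicit Types (T S X Y Z : adjop H H) (c d r q : R).

Definition bicomm X T : Prop := forall Z, GRing.comm Z X -> GRing.comm Z T.

Lemma comm_scale c Z T : GRing.comm Z T -> GRing.comm Z (c%:C *: T).
Proof. by move=> ZT; rewrite /GRing.comm mul_scale_adjop ZT scale_mul_adjop. Qed.

Lemma comm_inv Z T S : T * S = 1 -> S * T = 1 -> GRing.comm Z T -> GRing.comm Z S.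
Proof.
move=> TS ST ZT; rewrite /GRing.comm -[Z * S]mul1r -ST -!mulrA [T * _]mulrA -ZT.
by rewrite -mulrA TS mulr1.
Qed.

Lemma scale_half T : (2^-1)%:C *: T + (2^-1)%:C *: T = T.
Proof.
rewrite -scalerDl -rmorphD /=.
by have -> : 2^-1 + 2^-1 = 1 :> R by [lra]; rewrite scale1r.
Qed.

(** If [F = (X + F^2) / 2], then [(1 - F)^2 = 1 - X]. The ball of radius [rho = (1 + q) / 2] is
    preserved because [rho^2 <= 1], and [rho] is also the contraction constant on it. *)
Lemma sqrt_near_one X q : 0 <= q < 1 -> selfadj X -> opbound X q ->
  exists T, exists2 rho, 0 <= rho < 1 &
    [/\ selfadj T, T * T = 1 - X, opbound (1 - T) rho & bicomm X T].
Proof.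
move=> /andP[q0 q1] sX Xq; pose rho := (1 + q) / 2.
have rho0 : 0 <= rho by rewrite /rho; lra.
have rho1 : rho < 1 by rewrite /rho; lra.
have := @contraction_fixpoint _ _ _ X rho rho
  (fun T => (2^-1)%:C *: (X + T * T)) rho0.
case.
- by rewrite rho0.
- move=> T [sT Tb Tc]; split.
  + by apply/selfadjZ/selfadjD => //; exact: selfadjM.
  + apply: opbound_le (opboundZ _ (opboundD Xq (opboundM rho0 Tb Tb))).
    by rewrite ger0_norm // /rho; nra.
  + move=> Z ZX; apply/comm_scale/commrD => //.
    by apply: commrM; exact: Tc.
- move=> T S d [sT Tb Tc] [sS Sb Sc] d0 TSd.
  have -> : (2^-1)%:C *: (X + T * T) - (2^-1)%:C *: (X + S * S) =
     (2^-1)%:C *: (T * (T - S) + (T - S) * S).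
    rewrite -scalerBr mulrBr mulrBl addrA subrK; congr (_ *: _).
    by rewrite opprD addrACA subrr add0r.
  apply: opbound_le (opboundZ _ (opboundD (opboundM rho0 Tb TSd) (opboundM d0 TSd Sb))).
  by rewrite ger0_norm // le_eqVlt; apply/predU1P; left; field.
- move=> T [sT Tb Tc] TE; exists (1 - T), rho; first by rewrite rho0.
  split.
  + by apply: selfadjB => //; exact: selfadj1.
  + rewrite mulrBl mul1r mulrBr mulr1 opprB addrA.
    have -> : T * T = T + T - X.
      have -> : T + T = X + T * T by rewrite -{1 2}TE scale_half.
      by rewrite addrC addKr.
    by rewrite (AC (2*3*1) ((1*5)*((3*2)*(4*6)))) /= subrr !addr0.
  + by rewrite opprB addrC subrK.
  + by move=> Z ZX; apply: commrB; [exact: commr1 | exact: Tc].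
Qed.

(** The inverse is the fixed point of [T |-> 1 + X T]; the radius is preserved because
    [1 + q / (1 - q) = 1 / (1 - q)]. *)
Lemma neumann X q : 0 <= q < 1 -> selfadj X -> opbound X q ->
  exists T, [/\ selfadj T, T * (1 - X) = 1, (1 - X) * T = 1 &
                opbound T (1 - q)^-1].
Proof.
move=> /andP[q0 q1] sX Xq.
have q'0 : 0 <= (1 - q)^-1 by rewrite invr_ge0 subr_ge0 ltW.
have [|T TC|T S d _ _ d0 TSd|T [sT Tb Tc] TE] :=
    @contraction_fixpoint _ _ _ X _ q (fun T => 1 + X * T) q'0.
- by rewrite q0.
- have [sT Tb Tc] := TC; rewrite /=; split.
  + by apply: selfadjD; [exact: selfadj1 | apply: selfadjM => //; exact: Tc].
  + apply: opbound_le (opboundD opbound1 (opboundM q0 Xq Tb)).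
    by rewrite le_eqVlt; apply/predU1P; left; field; rewrite subr_eq0 gt_eqF.
  + move=> Z ZX; apply: commrD; first exact: commr1.
    by apply: commrM => //; exact: Tc.
- have -> : 1 + X * T - (1 + X * S) = X * (T - S).
    by rewrite mulrBr opprD addrACA subrr add0r.
  exact: opboundM.
- have XT : X * T = T * X by exact: Tc.
  by exists T; split; rewrite // ?mulrBl ?mulrBr ?mul1r ?mulr1 -?XT -{1}TE addrK.
Qed.

(* [X + iT] and [X - iT] are unitary, and [X] and [X^2 - T^2] are the real parts
   of [X + iT] and of its square.                                             *)
Lemma opbound_sum_sq1 X T : selfadj X -> selfadj T -> GRing.comm X T ->
  X * X + T * T = 1 -> opbound X 1 /\ opbound (X * X - T * T) 1.
Proof.
move=> sX sT XT XXTT; pose I : R[i] := 'i%C.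
have II : I * I = -1 by rewrite -expr2 sqr_i.
have cI : conjc I = - I := conjc_i R.
pose u := X + I *: T; pose v := X - I *: T.
have uE : adjL u = v by rewrite adjLD adjLZ sX sT cI scaleNr.
have vE : adjL v = u by rewrite -uE adjLK.
have expand (s t : R[i]) : (X + s *: T) * (X + t *: T) =
    X * X + (s * t) *: (T * T) + (s + t) *: (X * T).
  rewrite mulrDl !mulrDr !scale_mul_adjop !mul_scale_adjop -XT scalerA scalerDl.
  by rewrite addrAC -!addrA [X in _ + X]addrCA [X in _ + X]addrC addrA.
have vu : v * u = 1.
  by rewrite /u /v -scaleNr expand mulNr II opprK scale1r addNr scale0r addr0.
have uv : u * v = 1.
  by rewrite /u /v -scaleNr expand mulrN II opprK scale1r subrr scale0r addr0.
have ub : opbound u 1 by apply: opbound_isometry; rewrite uE.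
have vb : opbound v 1 by apply: opbound_isometry; rewrite vE.
have half (S S1 S2 : adjop H H) : S1 + S2 = S + S -> opbound S1 1 -> opbound S2 1 ->
    opbound S 1.
  move=> SS S1b S2b; rewrite -(scale_half S) -scalerDr -SS.
  apply: opbound_le (opboundZ _ (opboundD S1b S2b)).
  by rewrite ger0_norm //; lra.
split; first by apply: half ub vb; rewrite /u /v addrACA subrr addr0.
apply: (half _ (u * u) (v * v)).
- rewrite /u /v -scaleNr !expand mulrNN II scaleN1r -opprD scaleNr.
  by rewrite addrACA subrr addr0.
- by apply: opbound_le (opboundM ler01 ub ub); rewrite mulr1.
- by apply: opbound_le (opboundM ler01 vb vb); rewrite mulr1.
Qed.

(* The norm characterisation of positivity; unlike the form [adjL S * S], it is
   visibly stable under sums.                                                 *)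
Definition psd T : Prop := selfadj T /\
  exists2 e : R, 0 < e & forall t, 0 <= t <= e -> opbound (1 - t%:C *: T) 1.

(** Let [Y = sqrt (t / 2) X] and let [T] be a root of [1 - Y^2], which exists once [Y^2] is bounded
    by 1/2. Then [1 - t X^2 = T^2 - Y^2], and [opbound_sum_sq1] applies. *)
Lemma psd_sq X : selfadj X -> psd (X * X).
Proof.
move=> sX; split; first exact: selfadjM.
have [c c0 Xc] := opbound_exists X.
have d0 : 0 < c ^+ 2 + 1 by rewrite ltr_wpDl ?exprn_ge0.
exists (c ^+ 2 + 1)^-1 => [|t /andP[t0 te]]; first by rewrite invr_gt0.
pose Y := (Num.sqrt (t / 2))%:C *: X.
have sY : selfadj Y by exact: selfadjZ.
have YY : Y * Y = (t / 2)%:C *: (X * X).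
  rewrite scale_mul_adjop mul_scale_adjop scalerA -rmorphM /= -expr2 sqr_sqrtr //.
  by rewrite divr_ge0.
have YYb : opbound (Y * Y) (1 / 2).
  rewrite YY; apply: opbound_le (opboundZ _ (opboundM c0 Xc Xc)).
  rewrite ger0_norm ?divr_ge0 // mulrAC ler_pM2r ?invr_gt0 //.
  rewrite -(@mulVf _ (c ^+ 2 + 1)) ?gt_eqF // ler_pM ?mulr_ge0 // -expr2.
  by rewrite lerDl.
have [|T [rho _ [sT TT _ Tc]]] := sqrt_near_one _ (selfadjM sY sY erefl) YYb.
  by lra.
have YT : GRing.comm Y T by apply: Tc; rewrite /GRing.comm mulrA.
have [|_] := opbound_sum_sq1 sY sT YT; first by rewrite TT addrC subrK.
rewrite TT => /opboundN; rewrite !opprB.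
have -> : 1 - Y * Y - Y * Y = 1 - t%:C *: (X * X) => //.
rewrite -addrA -opprD YY -scalerDl -rmorphD /=.
by have -> : t / 2 + t / 2 = t by lra.
Qed.

(** [1 - t (X + Y)] is the mean of [1 - 2 t X] and [1 - 2 t Y], whence the halved range of [t]. *)
Lemma psdD X Y : psd X -> psd Y -> psd (X + Y).
Proof.
move=> [sX [e e0 Xe]] [sY [d d0 Yd]]; split; first exact: selfadjD.
exists (Num.min e d / 2) => [|t /andP[t0]].
  by rewrite divr_gt0 // lt_min e0 d0.
rewrite ler_pdivlMr // le_min => /andP[te td].
have -> : 1 - t%:C *: (X + Y) =
    (2^-1)%:C *: ((1 - (t * 2)%:C *: X) + (1 - (t * 2)%:C *: Y)).
  rewrite [in RHS]addrACA -opprD -scalerDr [RHS]scalerDr scalerN scalerA.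
  rewrite -rmorphM /= mulrCA mulVf // mulr1.
  by rewrite [(2^-1)%:C *: _]scalerDr scale_half.
apply: opbound_le (opboundZ _ (opboundD (Xe _ _) (Yd _ _))).
- by rewrite ger0_norm //; lra.
- by rewrite mulr_ge0.
- by rewrite mulr_ge0.
Qed.

(** For [t = e / (1 + e c)] one has [(1 - t c) e = t], hence [1 - t (c + X) = (1 - t c) (1 - e X)]:
    the shift turns the bound 1 into a strict one. *)
Lemma psd_shift X c : psd X -> 0 < c -> exists2 t, 0 < t < c^-1 &
  selfadj (1 - t%:C *: (c%:C *: (1 : adjop H H) + X)) /\
  opbound (1 - t%:C *: (c%:C *: (1 : adjop H H) + X)) (1 - t * c).
Proof.
move=> [sX [e e0 Xe]] c0; have ec : 0 < 1 + e * c by rewrite addr_gt0 // mulr_gt0.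
have tE : 1 - e / (1 + e * c) * c = (1 + e * c)^-1 by field; rewrite gt_eqF.
exists (e / (1 + e * c)).
  rewrite divr_gt0 //= ltr_pdivrMr // mulrDr mulr1 mulrCA mulVf ?gt_eqF //.
  by rewrite mulr1 ltrDr invr_gt0.
split; first by do ![apply: selfadjB | apply: selfadjZ | apply: selfadjD].
have -> : 1 - (e / (1 + e * c))%:C *: (c%:C *: (1 : adjop H H) + X) =
    (1 - e / (1 + e * c) * c)%:C *: (1 - e%:C *: X).
  rewrite scalerDr scalerA -rmorphM /= scalerBr scalerA -rmorphM /= tE.
  by rewrite -tE rmorphB /= scalerBl scale1r opprD addrA tE [e * _]mulrC.
apply: opbound_le (opboundZ _ (Xe e _)); last by rewrite lexx ltW.
by rewrite tE mulr1 ger0_norm // invr_ge0 ltW.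
Qed.

(** [neumann] inverts [t (c + X)] with bound [1 / (t c)]; rescaling by [t] leaves a bound that
    depends on [c] alone. *)
Lemma psd_shift_inv X c : psd X -> 0 < c -> exists T,
  [/\ selfadj T, T * (c%:C *: (1 : adjop H H) + X) = 1,
      (c%:C *: (1 : adjop H H) + X) * T = 1 & opbound T c^-1].
Proof.
move=> pX c0; have [t /andP[t0 tc] [sY Yb]] := psd_shift pX c0.
have tc01 : 0 <= 1 - t * c < 1.
  rewrite subr_ge0 gtrBl mulr_gt0 // andbT ltW // -(@mulVf _ c) ?gt_eqF //.
  by rewrite ltr_pM2r.
have [T [sT]] := neumann tc01 sY Yb.
rewrite opprB addrC subrK mul_scale_adjop scale_mul_adjop opprB.
rewrite [1 + _]addrC subrK invfM mulrC => TX XT Tb.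
exists (t%:C *: T); split; rewrite ?scale_mul_adjop ?mul_scale_adjop //.
  exact: selfadjZ.
apply: opbound_le (opboundZ _ Tb).
by rewrite gtr0_norm // mulrCA mulfV ?gt_eqF // mulr1.
Qed.

(** [sqrt_near_one] keeps its root near 1, so it can be applied twice. A fourth root makes the
    square root visibly positive, as the square of a self-adjoint operator. *)
Lemma psd_shift_root4 X c : psd X -> 0 < c -> exists T,
  [/\ selfadj T, T * T * (T * T) = c%:C *: (1 : adjop H H) + X & bicomm X T].
Proof.
move=> pX c0; have [t /andP[t0 tc] [sY Yb]] := psd_shift pX c0.
set Y := 1 - _ in sY Yb.
have tc01 : 0 <= 1 - t * c < 1.
  rewrite subr_ge0 gtrBl mulr_gt0 // andbT ltW // -(@mulVf _ c) ?gt_eqF //.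
  by rewrite ltr_pM2r.
have [S [rho rho01 [sS SS Sb Sc]]] := sqrt_near_one tc01 sY Yb.
have [T [_ _ [sT TT _ Tc]]] := sqrt_near_one rho01 (selfadjB selfadj1 sS) Sb.
rewrite opprB addrC subrK in TT.
have SSE : S * S = t%:C *: (c%:C *: (1 : adjop H H) + X) by rewrite SS opprB addrC subrK.
pose r := Num.sqrt (Num.sqrt t^-1).
have r4 : r * r * (r * r) = t^-1.
  by rewrite -!expr2 !sqr_sqrtr ?sqrtr_ge0 // invr_ge0 ltW.
exists (r%:C *: T); split.
- exact: selfadjZ.
- rewrite !(scale_mul_adjop, mul_scale_adjop, scalerA) -!rmorphM /=.
  rewrite TT SSE scalerA -rmorphM /= [X in X%:C](_ : _ = 1) ?scale1r //.
  by rewrite -(@mulVf _ t) ?gt_eqF // -r4; ring.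
- move=> Z ZX; apply/comm_scale/Tc/commrB; first exact: commr1.
  apply/Sc/commrB; first exact: commr1.
  by apply/comm_scale/commrD => //; apply/comm_scale/commr1.
Qed.

Lemma selfadj_inv T S : selfadj T -> T * S = 1 -> selfadj S -> S * T = 1.
Proof. by move=> sT TS sS; rewrite -sS -sT -adjLM TS adjL1. Qed.

Lemma sum_sq_bound X T c : 0 < c -> selfadj X -> selfadj T -> GRing.comm X T ->
  X * X + T * T = (c ^+ 2)%:C *: (1 : adjop H H) -> opbound X c.
Proof.
move=> c0 sX sT XT XXTT.
have [||||Xb _] := @opbound_sum_sq1 (c^-1%:C *: X) (c^-1%:C *: T).
- exact: selfadjZ.
- exact: selfadjZ.
- by apply/comm_scale/commr_sym/comm_scale/commr_sym.
- rewrite !(scale_mul_adjop, mul_scale_adjop, scalerA) -scalerDr XXTT scalerA.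
  by rewrite -!rmorphM /= -expr2 exprVn mulVf ?expf_neq0 ?gt_eqF // scale1r.
have -> : X = c%:C *: (c^-1%:C *: X).
  by rewrite scalerA -rmorphM /= mulfV ?gt_eqF // scale1r.
by apply: opbound_le (opboundZ _ Xb); rewrite mulr1 gtr0_norm.
Qed.

Lemma opbound_small_eq0 T : (forall e, 0 < e -> opbound T e) -> T = 0.
Proof.
move=> Te; apply: (@opbound_geometric_eq0 _ _ _ _ 1 (2^-1)); first by lra.
by move=> n; apply: Te; rewrite mul1r exprn_gt0 //; lra.
Qed.

(* The symmetrised element [b b^* + b^* b] is a sum of squares of self-adjoint
   elements; hence so is [b b^*] as soon as [b^* b = - k^2].                   *)
Lemma psd_mul_adj b k : selfadj k -> adjL b * b = - (k * k) -> psd (b * adjL b).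
Proof.
move=> sk bb; pose h : R := Num.sqrt 2^-1; pose I : R[i] := 'i%C.
have hh : h * h = 2^-1 by rewrite -expr2 sqr_sqrtr.
have II : I * I = -1 by rewrite -expr2 sqr_i.
have cI : conjc I = - I := conjc_i R.
pose p := b + adjL b; pose s := I *: (b - adjL b).
have sp : selfadj p by rewrite /selfadj adjLD adjLK addrC.
have ss : selfadj s.
  by rewrite /selfadj adjLZ cI adjLB adjLK scaleNr -scalerN opprB.
have -> : b * adjL b = (h%:C *: p) * (h%:C *: p) + (h%:C *: s) * (h%:C *: s) + k * k.
  have scale_sq (c : R[i]) (X : adjop H H) : (c *: X) * (c *: X) = (c * c) *: (X * X).
    by rewrite scale_mul_adjop mul_scale_adjop scalerA.
  rewrite !scale_sq II -rmorphM /= hh scaleN1r scalerN -scalerBr.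
  have -> : p * p - (b - adjL b) * (b - adjL b) =
     (b * adjL b - k * k) + (b * adjL b - k * k).
    rewrite /p !(mulrDl, mulrDr, mulrBl, mulrBr) !mulrN !mulNr -bb.
    rewrite !opprD !opprK (AC ((2*2)*(2*2)) ((1*5)*(4*8)*((2*3)*(6*7)))) /=.
    by rewrite !subrr !add0r.
  by rewrite scalerDr scale_half subrK.
by apply: psdD; [apply: psdD |]; apply: psd_sq => //; exact: selfadjZ.
Qed.

End FunctionalCalculus.

(** * Uniqueness of positive square roots *)

Section Positivity.
Context (R : realType) (A : cstarAlgType R) (H : hilbertModType A).
Implicit Types (T S X Y Z b k : adjop H H) (c d r q : R).

Local Notation one := (1 : adjop H H).

(** The reason is the intertwining [(c + adjL b * b) * adjL b = adjL b * (c + b * adjL b)]. *)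
Lemma resolvent_swap b c T : 0 < c ->
    (c%:C *: one + b * adjL b) * T = 1 ->
  (c%:C *: one + adjL b * b) * (c^-1%:C *: (1 - adjL b * T * b)) = 1.
Proof.
move=> c0 TS; rewrite mul_scale_adjop mulrBr mulr1.
have -> : (c%:C *: one + adjL b * b) * (adjL b * T * b) = adjL b * b.
  have -> : (c%:C *: one + adjL b * b) * (adjL b * T * b) =
      adjL b * ((c%:C *: one + b * adjL b) * T) * b.
    rewrite !mulrDl !mulrDr mulrDl !scale_mul_adjop mul_scale_adjop !mul1r.
    by rewrite scale_mul_adjop !mulrA.
  by rewrite TS mulr1.
by rewrite addrK scalerA -rmorphM /= mulVf ?gt_eqF // scale1r.
Qed.

(* By [resolvent_swap], [m - k^2 = m + b^* b] is invertible for every [m > 0],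
   with an inverse bounded uniformly in [m >= l^2]. It has a self-adjoint square
   root for large [m], and one for [m - dl] whenever it has one for [m]:
   [m - dl - k^2 = (m - k^2) (1 - dl (m - k^2)^-1)]. Hence [l^2 - k^2] is a square
   and [k] is bounded by [l], for every [l > 0].                              *)
Lemma adj_mul_neg_sq b k : selfadj k -> adjL b * b = - (k * k) -> k = 0.
Proof.
move=> sk bb; have pf := psd_mul_adj sk bb.
have [c c0 bc] := opbound_exists b; have [d d0 bd] := opbound_exists (adjL b).
have [e e0 ke] := opbound_exists (k * k).
apply: opbound_small_eq0 => l l0; pose l0' := l ^+ 2.
have l2 : 0 < l0' by rewrite exprn_gt0.
(* This bounds the inverse given by [resolvent_swap] for all [m >= l0'] at once, using
   [m^-1 <= l0'^-1]. *)
pose M := (1 + d * l0'^-1 * c) / l0'.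
have M0 : 0 < M by rewrite divr_gt0 // ltr_wpDr // !mulr_ge0 // invr_ge0 ltW.
pose G (m : R) : adjop H H := m%:C *: one - k * k.
have Ginv m : l0' <= m ->
    exists V, [/\ selfadj V, V * G m = 1, G m * V = 1 & opbound V M].
  move=> lm; have m0 := lt_le_trans l2 lm.
  have ml : m^-1 <= l0'^-1 by rewrite lef_pV2.
  have [T [sT TS ST Tb]] := psd_shift_inv pf m0.
  pose V : adjop H H := m^-1%:C *: (1 - adjL b * T * b).
  have GV : G m * V = 1 by rewrite -(resolvent_swap m0 ST) bb.
  have sV : selfadj V.
    by apply/selfadjZ/selfadjB => //; rewrite /selfadj !adjLM adjLK sT mulrA.
  have sG : selfadj (G m) by apply: selfadjB; [exact: selfadjZ | exact: selfadjM].
  exists V; split => //; first exact: selfadj_inv GV sV.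
  have := opboundM (mulr_ge0 d0 _) (opboundM d0 bd Tb) bc.
  rewrite invr_ge0 ltW // => /(_ isT) bTb.
  apply: opbound_le (opboundZ _ (opboundB opbound1 bTb)).
  rewrite ger0_norm ?invr_ge0 ?(ltW m0) // [X in _ <= X](mulrC _ l0'^-1).
  rewrite ler_pM // ?invr_ge0 ?(ltW m0) //.
    by rewrite addr_ge0 // !mulr_ge0 // invr_ge0 ltW.
  by rewrite lerD2l ler_wpM2r // ler_wpM2l.
(* With this step length [dl V] is bounded by 1/2 at every stage, so [1 - dl V] has a root. *)
pose dl := (2 * M)^-1.
have dl0 : 0 < dl by rewrite invr_gt0 mulr_gt0.
pose P (n : nat) := exists r : adjop H H,
  [/\ selfadj r, GRing.comm r k & r * r = G (l0' + n%:R * dl)].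
have descent n : P n.+1 -> P n.
  move=> [r [sr rk rr]].
  have [|V [sV VG GV Vb]] := Ginv (l0' + n.+1%:R * dl).
    by rewrite lerDl mulr_ge0 // ltW.
  have rV : GRing.comm r V.
    by apply: comm_inv GV VG _; rewrite -rr; apply: commrM.
  have kV : GRing.comm k V.
    by apply: comm_inv GV VG _; rewrite -rr; apply: commrM; apply: commr_sym.
  have sdV : selfadj (dl%:C *: V) by exact: selfadjZ.
  have dVb : opbound (dl%:C *: V) (1 / 2).
    apply: opbound_le (opboundZ _ Vb); rewrite gtr0_norm // /dl invfM -mulrA.
    by rewrite mulVf ?gt_eqF // mulr1 mul1r.
  have [|T [rho _ [sT TT _ Tc]]] := sqrt_near_one _ sdV dVb; first by lra.
  have rT : GRing.comm r T by apply/Tc/comm_scale.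
  have kT : GRing.comm k T by apply/Tc/comm_scale.
  exists (r * T); split; first exact: selfadjM.
    by apply: commr_sym; apply: commrM => //; exact: commr_sym.
  rewrite mulrA -[r * T * r]mulrA -rT mulrA -mulrA TT rr.
  rewrite mulrBr mulr1 mul_scale_adjop GV /G addrAC -scalerBl -rmorphB /=.
  by congr (_%:C *: _ - _); rewrite -addn1 natrD mulrDl mul1r addrA addrK.
have PP n : P n -> P 0%N by elim: n => // n IH /descent.
have [r [sr rk rr]] : P 0%N.
  (* Once [m] exceeds the bound [e] of [k^2], [m (1 - k^2 / m)] has a root directly, which starts
     the descent. *)
  pose n := (Num.bound (e / dl)).+1; apply: (PP n).
  set m := l0' + n%:R * dl.
  have em : e < m.
    rewrite /m ltr_pwDl // -ler_pdivrMr //.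
    have := archi_boundP (divr_ge0 e0 (ltW dl0)); rewrite /n.
    by move/ltW => /le_trans; apply; rewrite ler_nat.
  have m0 : 0 < m by exact: le_lt_trans em.
  have sX : selfadj (m^-1%:C *: (k * k)) by apply/selfadjZ/selfadjM.
  have Xb : opbound (m^-1%:C *: (k * k)) (e / m).
    by apply: opbound_le (opboundZ _ ke); rewrite gtr0_norm ?invr_gt0 // mulrC.
  have [|T [rho _ [sT TT _ Tc]]] := sqrt_near_one _ sX Xb.
    by rewrite divr_ge0 ?(ltW m0) // ltr_pdivrMr // mul1r.
  exists ((Num.sqrt m)%:C *: T); split; first exact: selfadjZ.
    apply/commr_sym/comm_scale/Tc/comm_scale.
    by rewrite /GRing.comm mulrA.
  rewrite scale_mul_adjop mul_scale_adjop scalerA -rmorphM /= -expr2.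
  rewrite sqr_sqrtr ?(ltW m0) // TT scalerBr scalerA -rmorphM /= mulfV ?gt_eqF //.
  by rewrite scale1r.
apply: (sum_sq_bound l0 sk sr); first exact: commr_sym.
by rewrite rr /G mul0r addr0 addrC subrK.
Qed.

(* With [V = Y - X], [(S V)^* (S V) = V X V = - V Y V = - (T V)^2]. *)
Lemma psd_sqrt_uniq X Y T S : X = adjL S * S -> Y = T * T -> selfadj T ->
  GRing.comm T X -> X * X = Y * Y -> X = Y.
Proof.
move=> XE YE sT TX XXYY.
have sX : selfadj X by rewrite /selfadj XE adjLM adjLK.
have sY : selfadj Y by rewrite YE; exact: selfadjM.
have XY : GRing.comm X Y by rewrite YE; apply: commrM; exact: commr_sym.
have TY : GRing.comm T Y by rewrite YE /GRing.comm mulrA.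
pose V := Y - X; have sV : selfadj V by exact: selfadjB.
have TV : GRing.comm T V by exact: commrB.
have YV : GRing.comm Y V by apply: commrB => //; exact: commr_sym.
have XV : GRing.comm X V by exact: commrB.
have key : adjL (S * V) * (S * V) = - ((T * V) * (T * V)).
  rewrite adjLM sV -mulrA (mulrA (adjL S)) -XE.
  have -> : T * V * (T * V) = Y * V * V.
    by rewrite mulrA -[T * V * T]mulrA -TV mulrA -YE.
  apply/eqP; rewrite mulrA -XV -addr_eq0 -!mulrDl; apply/eqP.
  suff -> : (X + Y) * V = 0 by rewrite mul0r.
  by rewrite mulrDl !mulrBr XXYY XY addrA subrK subrr.
have sTV : selfadj (T * V) by exact: selfadjM.
have TV0 := adj_mul_neg_sq sTV key.
have SV0 : S * V = 0 by apply: adjL_mul_eq0; rewrite key TV0 mulr0 oppr0.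
(* [V^2 = (Y - X) V = T (T V) - adjL S (S V) = 0]. *)
apply/eqP; rewrite eq_sym -subr_eq0; apply/eqP/adjL_mul_eq0.
rewrite -/V sV {1}/V mulrBl YE -mulrA TV0 mulr0 XE -mulrA SV0 mulr0.
by rewrite subrr.
Qed.

End Positivity.

(** * The matched projection *)

Section Selection.
Context (R : realType) (A : cstarAlgType R).

Lemma adj_uniq (E : ipModType A) (F : hermModType A) (T : E -> F) (S : F -> E) :
  adjoint_of T S -> adj T = S.
Proof.
move=> TS; apply/funext => y; apply: ip_ext => x.
by rewrite -TS -(adjP (ex_intro _ S TS)).
Qed.

Lemma opinv_uniq (E F : hermModType A) (T : E -> F) (S : F -> E) :
  S \o T = idfun -> T \o S = idfun -> opinv T = S.
Proof.
move=> ST TS.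
have [ST' _] : [set S : F -> E | S \o T = idfun /\ T \o S = idfun] (opinv T).
  by apply: (xgetPex (fun=> 0)); exists S.
apply/funext => y; have TSy : T (S y) = y := congr1 (@^~ y) TS.
by rewrite -[in LHS]TSy; exact: (congr1 (@^~ (S y)) ST').
Qed.

(** Two projections with the same range fix each other's values; moving them across the form then
    identifies them. *)
Lemma proj_onto_uniq (E : ipModType A) (S : submodule E) (P : E -> E) :
  is_projection P -> range P = [set` subm_pred S] -> proj_onto S = P.
Proof.
move=> Pproj PS.
have [[P'a P'i] P'S] : [set P : E -> E |
    is_projection P /\ range P = [set` subm_pred S]] (proj_onto S).
  by apply: (xgetPex (fun=> 0)); exists P.
have [Pa Pi] := Pproj; set P' := proj_onto S in P'a P'i P'S *.
have fix_range (F G : E -> E) : F \o F = F -> range F = range G ->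
    forall x, F (G x) = G x.
  move=> FF FG x; have : range F (G x) by rewrite FG; exists x.
  by move=> [z _ <-]; exact: (congr1 (@^~ z) FF).
have PP' := fix_range P P' Pi (etrans PS (esym P'S)).
have P'P := fix_range P' P P'i (etrans P'S (esym PS)).
apply/funext => x; apply: ip_ext => z.
by rewrite -[P x]P'P -!P'a -Pa PP'.
Qed.

Lemma val_corestrict (E : ipModType A) (S : submodule E) (T : Type)
    (f : T -> E) (x : T) : f x \in subm_pred S -> val (corestrict S f x) = f x.
Proof. by move=> fS; rewrite /corestrict insubdK. Qed.

Lemma ip_val (E : ipModType A) (S : submodule E) (x y : S) :
  ip x y = ip (val x) (val y).
Proof. by []. Qed.

Lemma val_rangeL (E F : ipModType A) (T : adjop E F) (x : rangeL T) :
  exists y, T y = val x.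
Proof. by have /asboolP := valP x. Qed.

Lemma val_nullL (E F : ipModType A) (T : adjop E F) (x : nullL T) :
  T (val x) = 0.
Proof. by have /eqP := valP x. Qed.

Lemma in_rangeL (E F : ipModType A) (T : adjop E F) y :
  T y \in subm_pred (rangeL T).
Proof. by apply/asboolP; exists y. Qed.

Lemma in_nullL (E F : ipModType A) (T : adjop E F) y :
  T y = 0 -> y \in subm_pred (nullL T).
Proof. by move=> Ty; rewrite inE Ty. Qed.

End Selection.

(** * The operator W of an idempotent *)

Section Idempotent.
Context (R : realType) (A : cstarAlgType R) (H : hilbertModType A).
Context (Q : adjop H H) (QQ : Q * Q = Q).
Local Notation Qs := (adjL Q).

Definition symm (Q : adjop H H) : adjop H H := Q + adjL Q - 1.
Local Notation W := (symm Q).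

Lemma adjL_idem : Qs * Qs = Qs.
Proof. by rewrite -adjLM QQ. Qed.
Let QsQs := adjL_idem.

Lemma symm_sqE : W * W = Q * Qs + Qs * Q - Q - Qs + 1.
Proof.
rewrite /symm mulrBr mulr1 mulrDr !mulrBl !mul1r !mulrDl QQ QsQs.
by rewrite (addrAC Q) subrr add0r addrK [Qs * Q + _]addrC !opprD opprK !addrA.
Qed.

Lemma selfadj_symm : selfadj W.
Proof. by rewrite /selfadj /symm adjLB adjLD adjLK adjL1 [Qs + _]addrC. Qed.

(** Idempotence cancels all but one term of [symm_sqE]. As [mul_symm_sq_idem] gives the same result,
    [Q] commutes with [W^2]. *)
Lemma mul_idem_symm_sq : Q * (W * W) = Q * Qs * Q.
Proof.
rewrite symm_sqE mulrDr !mulrBr mulrDr !mulrA mulr1 QQ.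
by rewrite (AC (4*1) ((1*4)*(3*5)*2)) /= subrr addNr !add0r.
Qed.

Lemma mul_symm_sq_idem : W * W * Q = Q * Qs * Q.
Proof.
rewrite symm_sqE mulrDl !mulrBl mulrDl mul1r -!mulrA QQ.
by rewrite (AC (4*1) ((2*4)*(3*5)*1)) /= subrr addNr !add0r.
Qed.

Lemma comm_idem_symm_sq : GRing.comm Q (W * W).
Proof. by rewrite /GRing.comm mul_idem_symm_sq mul_symm_sq_idem. Qed.

Lemma comm_adj_symm_sq : GRing.comm Qs (W * W).
Proof.
have /(congr1 (@adjL _ _ _ _)) := comm_idem_symm_sq.
by rewrite !adjLM !selfadj_symm.
Qed.

(* [W^2 = 1 + K^2] with [K = i (Q - Q^* )] self-adjoint. *)
Lemma symm_sq_psd : exists2 X : adjop H H,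
  psd X & W * W = (1 : R)%:C *: (1 : adjop H H) + X.
Proof.
pose I : R[i] := 'i%C.
have II : I * I = -1 by rewrite -expr2 sqr_i.
have cI : conjc I = - I := conjc_i R.
pose K := I *: (Q - Qs); exists (K * K).
  by apply: psd_sq; rewrite /selfadj adjLZ cI adjLB adjLK scaleNr -scalerN opprB.
rewrite scale_mul_adjop mul_scale_adjop scalerA II scaleN1r scale1r.
rewrite symm_sqE mulrBr !mulrBl QQ QsQs !opprB.
by rewrite (AC (5) (5*((1*4)*(2*3)))).
Qed.

Lemma symm_root4 : exists T : adjop H H,
  [/\ selfadj T, T * T * (T * T) = W * W & bicomm (W * W) T].
Proof.
have [X pX ->] := symm_sq_psd.
have [T [sT T4 TX]] := psd_shift_root4 pX ltr01.
exists T; split => // Z; rewrite scale1r => ZX; apply: TX.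
by rewrite -[X](addKr 1); apply: commrD => //; apply/commrN/commr1.
Qed.

Lemma symm_sq_inv : exists V : adjop H H,
  [/\ selfadj V, V * (W * W) = 1 & W * W * V = 1].
Proof.
have [X pX ->] := symm_sq_psd.
by have [V [sV VX XV _]] := psd_shift_inv pX ltr01; exists V.
Qed.

End Idempotent.

(* With [q p = p], the left-hand side is the sum of the entries of the matrix
   of [2 m(Q)] in the decomposition [p + (1 - p) = 1], with [M = m^-1] for the
   operator [B] and [J = (1 + M)^-1].                                        *)
Lemma matched_identity (K : pzRingType) (q qs p m M J : K) :
    q * p = p -> qs * p = qs -> M * m = 1 -> m * M = 1 ->
    GRing.comm qs m -> GRing.comm qs J -> GRing.comm m J -> J * (1 + M) = 1 ->
    (qs - 1) * (q - p) = (M * M - 1) * (1 - p) ->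
  M * m * p + m * p + m * (q * (1 - p)) +
    ((qs - 1) * (m * p) + (qs - 1) * (J * m * (q * (1 - p)))) =
  1 + m * (q + qs - 1).
Proof.
move=> qp qsp Mm mM qsm qsJ mJ JM corner.
have qN : q * (1 - p) = q - p by rewrite mulrBr mulr1 qp.
have qs1m : GRing.comm (qs - 1) m.
  by apply/commr_sym/commrB; [exact: commr_sym | exact: commr1].
have qs1J : GRing.comm (qs - 1) J.
  by apply/commr_sym/commrB; [exact: commr_sym | exact: commr1].
have -> : (qs - 1) * (m * p) = m * (qs - p).
  by rewrite mulrA qs1m -mulrA mulrBl mul1r qsp.
(* [corner] replaces [A^* A] by [M^2 - 1 = (1 + M) (M - 1)] on the complement of [p]; [J] cancels
   the first factor and [m] turns the second into [1 - m]. *)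
have -> : (qs - 1) * (J * m * (q * (1 - p))) = (1 - m) * (1 - p).
  rewrite qN !mulrA qs1J -[J * _ * m]mulrA qs1m mulrA -mulrA corner mulrA.
  congr (_ * _); rewrite -mJ -mulrA.
  have -> : M * M - 1 = (1 + M) * (M - 1).
    by rewrite mulrDl mul1r mulrBr mulr1 [RHS]addrC addrA subrK.
  by rewrite (mulrA J) JM mul1r mulrBr mM mulr1.
rewrite Mm mul1r qN !mulrBr !mulrBl mulrDr !mul1r !mulr1 !opprB.
rewrite (AC ((2*2)*(2*(2*2))) ((7*((3*5)*8))*((1*10)*((2*4)*(9*6))))) /=.
by rewrite !subrr !addr0.
Qed.

(** * The matrix of m(Q), computed with operators on the whole module *)

Section Matched.
Context (R : realType) (A : cstarAlgType R) (H : hilbertModType A).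
Context (Q : adjop H H) (QQ : Q * Q = Q).
Local Notation Qs := (adjL Q).
Local Notation W := (symm Q).
Local Notation RQ := (rangeL Q).
Local Notation NQ := (nullL (adjL Q)).
Context (T : adjop H H) (sT : selfadj T) (T4 : T * T * (T * T) = W * W)
  (TW : bicomm (W * W) T).
Context (V : adjop H H) (sV : selfadj V) (VW : V * (W * W) = 1)
  (WV : W * W * V = 1).

(** These are |W| and its inverse. *)
Local Notation M := (T * T).
Local Notation m := (T * T * V).
Context (P : adjop H H) (P_def : P = Q * Qs * V).

Let QW : GRing.comm Q (W * W). Proof. exact: comm_idem_symm_sq. Qed.
Let QsW : GRing.comm Qs (W * W). Proof. exact: comm_adj_symm_sq. Qed.
Let QT : GRing.comm Q T. Proof. exact: TW. Qed.
Let QsT : GRing.comm Qs T. Proof. exact: TW. Qed.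
Let QV : GRing.comm Q V. Proof. exact: comm_inv WV VW QW. Qed.
Let QsV : GRing.comm Qs V. Proof. exact: comm_inv WV VW QsW. Qed.
Let TV : GRing.comm T V.
Proof. by apply: comm_inv WV VW _; apply/commr_sym/TW. Qed.
Let Qm : GRing.comm Q m. Proof. by do ?apply: commrM. Qed.
Let Qsm : GRing.comm Qs m. Proof. by do ?apply: commrM. Qed.
Let mM : m * M = 1.
Proof.
rewrite -mulrA; have <- : M * V = V * M by apply/commr_sym/commrM; apply: commr_sym.
by rewrite mulrA T4.
Qed.
Let Mm : M * m = 1. Proof. by rewrite mulrA T4. Qed.

Let opE (S S' : adjop H H) h : S = S' -> S h = S' h.
Proof. by move=> ->. Qed.

Let PE : P = V * (Q * Qs).
Proof. by rewrite P_def; apply/commr_sym/commrM; apply: commr_sym. Qed.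
Let PQ : P * Q = Q.
Proof. by rewrite PE -mulrA -(mul_idem_symm_sq QQ) QW mulrA VW mul1r. Qed.
Let QP : Q * P = P. Proof. by rewrite P_def !mulrA QQ. Qed.
Let sP : selfadj P.
Proof. by rewrite /selfadj {1}P_def !adjLM adjLK sV PE. Qed.
Let QsP : Qs * P = Qs. Proof. by rewrite -sP -adjLM PQ. Qed.
Let PP : P * P = P. Proof. by rewrite {2}P_def !mulrA PQ. Qed.

Let valQ (x : RQ) : Q (val x) = val x.
Proof. by have [y <-] := val_rangeL x; rewrite -mul_adjopE QQ. Qed.
Let valP' (x : RQ) : P (val x) = val x.
Proof. by have [y <-] := val_rangeL x; rewrite -mul_adjopE PQ. Qed.
Let valQs (y : NQ) : Qs (val y) = 0. Proof. exact: val_nullL. Qed.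
Let valPN (y : NQ) : P (val y) = 0.
Proof. by rewrite PE !mul_adjopE valQs !adjop0. Qed.

Let inRQ y : Q y = y -> y \in subm_pred RQ.
Proof. by move=> <-; exact: in_rangeL. Qed.

(** [P Q = Q] since [Q Q^* Q = W^2 Q], and [Q P = P] since [Q] is idempotent, so the ranges agree;
    [P] is self-adjoint because [V] commutes with [Q] and [Q^*]. *)
Lemma proj_rangeL : proj_onto RQ = P.
Proof.
apply: proj_onto_uniq; first split.
- by move=> x y; rewrite ip_adj sP.
- by apply/funext => x; exact: (opE x PP).
apply/seteqP; split => y /=.
  by move=> [x _ <-]; apply: inRQ; exact: (opE x QP).
move=> /asboolP[x <-]; exists (Q x) => //.
exact: (opE x PQ).
Qed.

Let U1 h : val (mp_U Q h).1 = P h.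
Proof.
rewrite /mp_U /= proj_rangeL val_corestrict //.
by apply: inRQ; exact: (opE h QP).
Qed.

Let U2 h : val (mp_U Q h).2 = h - P h.
Proof.
rewrite /mp_U /= proj_rangeL val_corestrict //.
apply: in_nullL; have QsPN : Qs * (1 - P) = 0.
  by rewrite mulrBr mulr1 QsP subrr.
exact: (opE h QsPN).
Qed.

Lemma adj_mp_U : adj (mp_U Q) = (fun u => val u.1 + val u.2).
Proof.
apply: adj_uniq => h u.
have -> : ip (mp_U Q h) u =
    ip (val (mp_U Q h).1) (val u.1) + ip (val (mp_U Q h).2) (val u.2) by [].
rewrite U1 U2 ipBl !ip_adj sP valP' valPN ip0r subr0 ipDr.
by [].
Qed.

Local Notation mpA := (@mp_A _ _ _ Q).

(** [P = V Q Q^*] vanishes on the kernel of [Q^*]. *)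
Lemma val_mp_A (y : NQ) : val (mpA y) = Q (val y).
Proof.
rewrite /mp_A proj_rangeL.
have QPy : ((Q \- P) \o val) y = Q (val y) by rewrite /= valPN subr0.
by rewrite val_corestrict QPy //; exact: in_rangeL.
Qed.

Let A' : RQ -> NQ := corestrict NQ (fun x => Qs (val x) - val x).

Let val_A' x : val (A' x) = Qs (val x) - val x.
Proof.
rewrite val_corestrict //; apply: in_nullL.
rewrite -scaleN1r adjopD adjopZ scaleN1r.
by rewrite (opE (val x) (adjL_idem QQ) : Qs (Qs (val x)) = _) subrr.
Qed.

(** Subtracting [x] from [Q^* x] lands in the kernel of [Q^*] and leaves the pairing unchanged, the
    range of [Q] being orthogonal to that kernel. *)
Lemma adj_mp_A : adj (mpA) = A'.
Proof.
apply: adj_uniq => y x; rewrite !ip_val val_mp_A val_A' ipBr ip_adj.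
have := ip_adj Qs (val y) (val x).
by rewrite valQs ip0l adjLK valQ => <-; rewrite subr0.
Qed.

Let res (X : adjop H H) : RQ -> RQ := corestrict RQ (fun x => X (val x)).

Let val_res X x : GRing.comm Q X -> val (res X x) = X (val x).
Proof.
move=> QX; rewrite val_corestrict //; apply: inRQ.
by rewrite (opE (val x) QX : Q (X (val x)) = _) mul_adjopE valQ.
Qed.

Let res_adjoint X : selfadj X -> GRing.comm Q X -> adjoint_of (res X) (res X).
Proof. by move=> sX QX x y; rewrite !ip_val !val_res // ip_adj sX. Qed.

Let QM : GRing.comm Q M. Proof. exact: commrM. Qed.

(** On the range, [A A^* x = Q (Q^* x - x) = Q Q^* x - x], and [Q Q^* Q = W^2 Q]. *)
Let res_sq : (mpA \o adj (mpA)) \+ idfun = res (W * W).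
Proof.
apply/funext => x; apply: val_inj; rewrite /= adj_mp_A.
rewrite val_res // [LHS](_ : _ = val (mpA (A' x)) + val x) //.
rewrite val_mp_A val_A' -scaleN1r adjopD adjopZ scaleN1r valQ subrK.
rewrite -(valQ x); exact: (esym (opE (val x) (mul_symm_sq_idem QQ))).
Qed.

Let valcP h : val (corestrict RQ P h) = P h.
Proof. by rewrite val_corestrict //; apply: inRQ; exact: (opE h QP). Qed.

Let cPval (x : RQ) : corestrict RQ P (val x) = x.
Proof. by apply: val_inj; rewrite valcP valP'. Qed.

Let ext_adjoint (X : adjop RQ RQ) :
  adjoint_of (fun h => val (X (corestrict RQ P h)))
             (fun h => val (adjL X (corestrict RQ P h))).
Proof.
move=> h k; rewrite -[val (X _)]valP' -[val (adjL X _)]valP'.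
have Pip (u v : H) : ip u (P v) = ip (P u) v by rewrite ip_adj sP.
rewrite Pip -Pip -!valcP -!ip_val; exact: ip_adj.
Qed.

(** Extension by 0 carries operators on the range to the Hilbert module [H], where [psd_sqrt_uniq]
    applies. *)
Let ext (X : adjop RQ RQ) : adjop H H := AdjOp (ex_intro _ _ (ext_adjoint X)).

Let extM X Y : ext (X * Y) = ext X * ext Y.
Proof. by apply: adjop_eq => h; rewrite !mul_adjopE /= cPval. Qed.

Let extP X : ext X * P = ext X.
Proof.
apply: adjop_eq => h; rewrite mul_adjopE /=; congr (val (X _)).
by apply: val_inj; rewrite !valcP (opE h PP : P (P h) = _).
Qed.

Let Pext X : P * ext X = ext X.
Proof. by apply: adjop_eq => h; rewrite mul_adjopE /= valP'. Qed.

Let TP : GRing.comm T P.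
Proof.
by rewrite P_def; apply: commrM => //; apply: commrM; exact: commr_sym.
Qed.

Let WP : GRing.comm (W * W) P.
Proof. by apply: commr_sym; rewrite -T4; do ?apply: commrM; exact: commr_sym. Qed.

(** [res M] is an admissible root, being the square of the self-adjoint [res T]. Whichever root is
    selected, its extension equals [M P = (T P)^2] by [psd_sqrt_uniq]. *)
Lemma mp_B_root : @mp_B _ _ _ Q = res M.
Proof.
have QTP : adjoint_of (res T) (res T) by exact: res_adjoint.
have [[S [Sadj BE]] BB] : [set B : RQ -> RQ | op_pos B /\
    B \o B = (mpA \o adj mpA) \+ idfun] (@mp_B _ _ _ Q).
  apply: (xgetPex (fun=> 0)); exists (res M); split.
    exists (res T); split; first by exists (res T).
    rewrite (adj_uniq QTP); apply/funext => x; apply: val_inj.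
    by rewrite /= !val_res.
  rewrite res_sq; apply/funext => x; apply: val_inj.
  by rewrite /= !val_res // -T4.
pose SL : adjop RQ RQ := AdjOp Sadj.
pose BL : adjop RQ RQ := adjL SL * SL.
have BLE : @mp_B _ _ _ Q = BL by rewrite BE.
have XX : ext BL * ext BL = W * W * P.
  rewrite -extM; apply: adjop_eq => h; rewrite mul_adjopE -valcP.
  have := congr1 (@^~ (corestrict RQ P h)) BB.
  by rewrite BLE res_sq /= => ->; rewrite val_res.
have extB : ext BL = M * P.
  apply: (@psd_sqrt_uniq _ _ _ _ _ (T * P) (ext SL)).
  - rewrite extM; congr (_ * _).
    by apply/esym/adjL_uniq => x y; rewrite ext_adjoint.
  - by rewrite -[RHS]mulrA [P * _]mulrA -TP -!mulrA PP.
  - exact: selfadjM.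
  - have XW : GRing.comm (ext BL) (W * W).
      rewrite /GRing.comm -[ext BL in LHS]extP -[ext BL in RHS]Pext.
      by rewrite -mulrA -WP -XX [RHS]mulrA -XX mulrA.
    apply: commr_sym; apply: commrM; last by rewrite /GRing.comm extP Pext.
    exact: TW.
  - have PM : P * M = M * P by apply/commr_sym/commr_sym/commrM; apply: commr_sym.
    by rewrite XX -T4 -[RHS]mulrA (mulrA P) PM -(mulrA _ P P) PP -mulrA.
rewrite BLE; apply/funext => x; apply: val_inj; rewrite val_res //.
by have := opE (val x) extB; rewrite mul_adjopE /= cPval valP'.
Qed.

Let resM X Y : GRing.comm Q X -> GRing.comm Q Y -> res X \o res Y = res (X * Y).
Proof.
move=> QX QY; apply/funext => x; apply: val_inj.
by rewrite /= !val_res //; exact: commrM.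
Qed.

Let res1 : res 1 = idfun.
Proof. by apply/funext => x; apply: val_inj; rewrite val_res //; exact: commr1. Qed.

Let opinv_res X Y : GRing.comm Q X -> X * Y = 1 -> Y * X = 1 ->
  opinv (res X) = res Y.
Proof.
move=> QX XY YX; have QY := comm_inv XY YX QX.
by apply: opinv_uniq; rewrite resM // ?XY ?YX res1.
Qed.

Lemma matched_projectionE : ~ is_projection Q ->
  matched_projection Q = ((2^-1)%:C *: (1 + m * W) : adjop H H).
Proof.
move=> nproj; rewrite /matched_projection ifN; last by apply/asboolPn.
have [J [sJ JM MJ _]] := psd_shift_inv (psd_sq sT) ltr01.
rewrite scale1r in JM MJ.
have QM1 : GRing.comm Q (1 + M) by apply: commrD => //; exact: commr1.
have QJ : GRing.comm Q J by exact: comm_inv MJ JM QM1.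
have QsJ : GRing.comm Qs J.
  by apply: comm_inv MJ JM _; apply: commrD; [exact: commr1 | exact: commrM].
have invB : opinv (@mp_B _ _ _ Q) = res m by rewrite mp_B_root; exact: opinv_res.
have invBB : opinv (@mp_B _ _ _ Q \o (@mp_B _ _ _ Q \+ idfun)) = res (J * m).
  rewrite mp_B_root.
  have -> : res M \+ idfun = res (1 + M).
    apply/funext => x; apply: val_inj; rewrite val_res // add_adjopE addrC.
    by rewrite -(val_res _ QM).
  rewrite resM //; apply: opinv_res; first exact: commrM.
    by rewrite mulrA -[_ * _ * J]mulrA MJ mulr1.
  by rewrite mulrA -[_ * _ * M]mulrA mM mulr1.
have mJ : GRing.comm m J.
  apply: comm_inv MJ JM _; apply: commrD; first exact: commr1.
  by rewrite /GRing.comm mM Mm.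
(* This is [A^* A = W^2 - 1] on the kernel of [Q^*], extended by 0. *)
have corner : (Qs - 1) * (Q - P) = (M * M - 1) * (1 - P).
  have WWP : W * W * P = Q * Qs by rewrite PE mulrA WV mul1r.
  rewrite T4; move: WWP (symm_sqE QQ); move: (W * W) => w wP wE.
  rewrite !mulrBl !mulrBr QsP !mul1r mulr1 wP wE !opprB.
  rewrite (AC (2*2) ((1*3)*(2*4))) /=.
  rewrite [in RHS](AC ((5*1)*2) ((2*7)*((4*3)*((1*6)*(5*8))))) /=.
  by rewrite !subrr !addr0.
have opid := matched_identity QP QsP Mm mM Qsm QsJ mJ JM corner.
apply/funext => h; rewrite adj_mp_U /mp_matrix invB invBB adj_mp_A.
rewrite mp_B_root scale_adjopE -(opE h opid) fmorphV rmorph_nat.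
pose u := mp_U Q h; pose x := res m u.1; pose y := res m (mpA u.2).
pose z := res (J * m) (mpA u.2).
rewrite [LHS](_ : _ = 2^-1 *: (val (res M x) + val x + val y) +
                      2^-1 *: (val (A' x) + val (A' z))) //.
rewrite -scalerDr !val_A' !val_res // ?val_mp_A; last exact: commrM.
by rewrite U1 U2.
Qed.

End Matched.

Section OneMinus.
Context (R : realType) (A : cstarAlgType R) (H : hilbertModType A).
Implicit Types Q : adjop H H.

Lemma symm_one_minus Q : symm (1 - Q) = - symm Q.
Proof.
rewrite /symm adjLB adjL1 !opprD opprK (AC (2*2*1) ((2*4*1)*(3*5))) /=.
by rewrite subrr addr0.
Qed.

Lemma is_projectionE Q : is_projection Q <-> selfadj Q /\ Q * Q = Q.
Proof.
split=> [[sQ iQ]|[sQ QQ]]; split.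
- exact: adjL_uniq.
- by apply: adjop_eq => x; exact: (congr1 (@^~ x) iQ).
- by move=> x y; rewrite ip_adj sQ.
- by apply/funext => x; exact: (congr1 (fun S : adjop H H => S x) QQ).
Qed.

Lemma idem_one_minus Q : Q * Q = Q -> (1 - Q) * (1 - Q) = 1 - Q.
Proof. by move=> QQ; rewrite mulrBr mulr1 mulrBl mul1r QQ subrr subr0. Qed.

Lemma is_projection_one_minus Q : is_projection Q -> is_projection (1 - Q).
Proof.
move=> /is_projectionE[sQ QQ]; apply/is_projectionE.
by split; [exact: selfadjB | exact: idem_one_minus].
Qed.

End OneMinus.

Theorem theorem3p14 (R : realType) (A : cstarAlgType R) (H : hilbertModType A)
    (Q : adjop H H) (idemQ : is_idempotent Q) :
  matched_projection (one_minusL Q) = (idfun \- matched_projection Q)%R.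
Proof.
have QQ : Q * Q = Q by apply: adjop_eq => x; exact: (congr1 (@^~ x) idemQ).
rewrite one_minusLE.
have [pQ|npQ] := pselect (is_projection Q).
  rewrite /matched_projection !ifT //; first exact/asboolP.
  exact/asboolP/is_projection_one_minus.
have npQ' : ~ is_projection (1 - Q).
  move=> /is_projection_one_minus; rewrite opprB addrC subrK; exact: npQ.
have [T [sT T4 TW]] := symm_root4 QQ; have [V [sV VW WV]] := symm_sq_inv QQ.
(* Since [W^2] is unchanged, the same [T] and [V] serve for [Q] and [1 - Q]; only the factor [W]
   changes sign. *)
have WW : symm (1 - Q) * symm (1 - Q) = symm Q * symm Q.
  by rewrite symm_one_minus mulrNN.
rewrite (matched_projectionE QQ sT T4 TW sV VW WV erefl npQ).
rewrite -WW in T4 TW VW WV.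
rewrite (matched_projectionE (idem_one_minus QQ) sT T4 TW sV VW WV erefl npQ').
rewrite symm_one_minus; apply/funext => h; rewrite mulrN.
set X := T * T * V * symm Q.
have -> : (2^-1)%:C *: (1 - X) = 1 - (2^-1)%:C *: (1 + X).
  apply: (addIr ((2^-1)%:C *: (1 + X))); rewrite subrK -scalerDr addrACA.
  by rewrite addNr addr0 scalerDr scale_half.
by [].
Qed.
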